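(* Let $n,a,b,c,d,N\ge 0$ be integers. Let $\lambda=((n+b+c)^{n+a},(n+c)^{d})$ and let $\pi=\lambda/(c^a)$. Then \[ s_\pi(1,q,q^2,\dots,q^N) =q^{\sum_{(i,j)\in \lambda/(c^a)}(\lambda_j ' -i)} \prod_{i=1}^{b}(q^{N-a +1+i};q)_{a} \prod_{i=1}^{d} (q^{N+2-i};q)_{c} \prod_{i=1}^n (q^{N-n-a-d+1+i};q)_{n+a+b+c+d} \] \[ \times \prod_{i=1}^n \prod_{j=1}^{a}\prod_{k=1}^{c}\frac{1-q^{i+j+k-1}}{1-q^{i+j+k-2}} \cdot \prod_{(i,j)\in \lambda\setminus(0^n,c^a)}\frac{1}{1-q^{h_\lambda (i,j)}}. \]
   Context: Partitions are identified with their Young diagrams $\{(i,j):1\le i\le\ell(\lambda),1\le j\le\lambda_i\}$; $(x^k)$ denotes $k$ parts equal to $x$; $\lambda/\mu$ is the set difference of diagrams. $\lambda'$ is the conjugate partition and $h_\lambda(i,j)=\lambda_i+\lambda'_j-i-j+1$ is the hook length. $(0^n,c^a)$ denotes the set of cells $(c^{n+a})/(c^n)$, i.e. the $a\times c$ rectangle of cells $(i,j)$ with $n+1\le i\le n+a$, $1\le j\le c$. $(x;q)_k=(1-x)(1-xq)\cdots(1-xq^{k-1})$. A semistandard Young tableau of shape $\pi$ is a filling of the cells of $\pi$ by nonnegative integers, weakly increasing along rows and strictly increasing down columns; $s_\pi(1,q,\dots,q^N)=\sum_T q^{|T|}$, the sum over semistandard Young tableaux $T$ of shape $\pi$ with all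 entries in $\{0,1,\dots,N\}$, where $|T|$ is the sum of the entries. *)

(* Defs.v *)
From HB Require Import structures.
From mathcomp Require Export all_boot all_order all_algebra.

Set Implicit Arguments.
Unset Strict Implicit.
Unset Printing Implicit Defensive.

Import Order.TTheory GRing.Theory Num.Theory.
Local Open Scope ring_scope.

(* A partition is a weakly decreasing sequence of natural numbers; trailing
   zero parts are allowed and do not affect the notions below.  Rows, columns
   and cells are numbered from 1. *)
Definition cell : Type := (nat * nat)%type.

Definition part (lam : seq nat) (i : nat) : nat := nth 0%N lam i.-1.

Definition conj_part (lam : seq nat) (j : nat) : nat := count (leq j) lam.

Definition diagram (lam : seq nat) : seq cell :=
  [seq (i, j) | i <- iota 1 (size lam), j <- iota 1 (part lam i)].

Definition cells_diff (A B : seq cell) : seq cell :=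
  [seq x <- A | x \notin B].

Definition skew (lam mu : seq nat) : seq cell :=
  cells_diff (diagram lam) (diagram mu).

Definition hook (lam : seq nat) (x : cell) : int :=
  (part lam x.1)%:Z + (conj_part lam x.2)%:Z - x.1%:Z - x.2%:Z + 1.

Definition semistandard (pi : seq cell) (N : nat)
    (T : {ffun seq_sub pi -> 'I_N.+1}) : bool :=
  [forall x : seq_sub pi, forall y : seq_sub pi,
     (((val x).1 == (val y).1) && ((val x).2 < (val y).2)%N
        ==> (T x <= T y)%N)
  && (((val x).2 == (val y).2) && ((val x).1 < (val y).1)%N
        ==> (T x < T y)%N)].

(* The principal specialization s_pi(1, q, ..., q^N). *)
Definition schur_principal (F : fieldType) (pi : seq cell) (N : nat) (q : F)
    : F :=
  \sum_(T : {ffun seq_sub pi -> 'I_N.+1} | semistandard T)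
     q ^+ (\sum_(x : seq_sub pi) T x)%N.

Definition qpoch (F : fieldType) (x q : F) (k : nat) : F :=
  \prod_(0 <= m < k) (1 - x * q ^+ m).

(* The indeterminate q of the field Q(q). *)
Definition ratq : {fraction {poly rat}} := tofrac 'X.

(* Main.v *)
(** The tableau sum is evaluated by the Jacobi-Trudi determinant
    [det h_(lam_i - i - mu_j + j)], proved by removing the largest letter: both
    sides satisfy the same recursion over interlacing partitions.

    Write [S(n,a,d)] for the determinant of the shape of the theorem, with
    [b, c] and the number of variables fixed.  Desnanot-Jacobi condensation
    stays inside this family:
      [S(n,a,d) S(n,a-1,d-1) =
         S(n,a-1,d) S(n,a,d-1) - S(n+1,a-1,d-1) S(n-1,a,d)].
    The closed form satisfies the same recursion, by
      [V (1 - Z) (1 - W) = (1 - Z V) (1 - W V) - (1 - Z W V) (1 - V)],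
    and does not vanish as soon as the number of variables is at least the
    number of rows, so induction reduces to the boundary.  For [a = 0] the shape
    is straight, so that the bialternant formula gives a quotient of two
    Vandermonde determinants; for [d = 0] its rotation by 180 degrees is
    straight; for [n = 0] it is a disjoint union of two rectangles.

    Finally both sides of the theorem are polynomials in [q^N], so that an
    identity for large [N] holds for all [N]. *)

Require Import Defs.
From mathcomp Require Import perm zify ring.
Set Implicit Arguments.
Unset Strict Implicit.
Unset Printing Implicit Defensive.
Import GRing.Theory.
Local Open Scope ring_scope.

(** * Determinants *)

Section DesnanotJacobi.

Variable R : comNzRingType.

Lemma det_add1mx_mul m n (A : 'M[R]_(m, n)) (B : 'M[R]_(n, m)) :
  \det (1%:M + A *m B) = \det (1%:M + B *m A).
Proof.
pose U := block_mx 1%:M A 0 1%:M; pose C := block_mx 1%:M (- A) B 1%:M.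
have detU : \det U = 1 by rewrite det_ublock !det1 mulr1.
have detUC : \det (U *m C) = \det (1%:M + A *m B).
  rewrite mulmx_block !mul1mx !mul0mx mulmx1 addNr !add0r.
  by rewrite det_lblock det1 mulr1.
rewrite -detUC det_mulmx mulrC -det_mulmx mulmx_block.
rewrite !mul1mx !mulmx0 !mulmx1 !addr0 subrr.
by rewrite det_lblock det1 mul1r addrC.
Qed.

Lemma det_mx22 (A : 'M[R]_2) : \det A = A 0 0 * A 1 1 - A 0 1 * A 1 0.
Proof.
have lift0 : lift 0 0 = 1 :> 'I_2 by apply: val_inj.
have lift1 : lift 1 0 = 0 :> 'I_2 by apply: val_inj.
rewrite (expand_det_row _ 0) !big_ord_recl big_ord0 /cofactor !det_mx11 !mxE.
by rewrite lift0 lift1 expr0 mul1r expr1 mulN1r mulrN addr0.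
Qed.

Definition replace_cols n (k l : 'I_n) (u v : 'I_n -> R) (A : 'M[R]_n) :=
  \matrix_(i, j) if j == k then u i else if j == l then v i else A i j.

Lemma det_replace_cols1 n (k l : 'I_n) (u v : 'I_n -> R) : k != l ->
  \det (replace_cols k l u v 1%:M) = u k * v l - v k * u l.
Proof.
move=> kl; have lk : (l == k) = false by rewrite eq_sym (negbTE kl).
pose U : 'M[R]_(n, 2) :=
  \matrix_(i, t) if t == 0 then u i - (i == k)%:R else v i - (i == l)%:R.
pose V : 'M[R]_(2, n) := \matrix_(t, j) (j == if t == 0 then k else l)%:R.
have -> : replace_cols k l u v 1%:M = 1%:M + U *m V.
  apply/matrixP=> i j; rewrite !mxE !big_ord_recl big_ord0 !mxE /= addr0.
  case: (eqVneq j k) => [->|_]; first by rewrite (negbTE kl) /=; ring.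
  by case: (eqVneq j l) => [->|_] /=; ring.
have VU t s : (1%:M + V *m U) t s =
              (t == s)%:R + U (if t == 0 then k else l) s.
  rewrite mxE [1%:M _ _]mxE mxE (bigD1 (if t == 0 then k else l)) //=.
  rewrite mxE eqxx mul1r big1 ?addr0 // => i /negbTE it.
  by rewrite mxE it mul0r.
rewrite det_add1mx_mul det_mx22 !VU !mxE /= !eqxx lk (negbTE kl) /=; ring.
Qed.

Definition central_minor n (A : 'M[R]_n.+2) : R :=
  \det (row' ord_max (col' ord_max (row' ord0 (col' ord0 A)))).

Lemma lift0_ord_max n : lift ord0 ord_max = ord_max :> 'I_n.+2.
Proof. exact: val_inj. Qed.

Lemma det_replace_extreme_cols n (c : R) (A : 'M[R]_n.+2) :
  \det (replace_cols ord0 ord_max (fun i => c *+ (i == ord0))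
                                  (fun i => c *+ (i == ord_max)) A) =
  c ^+ 2 * central_minor A.
Proof.
set B := replace_cols _ _ _ _ _.
have col0 i : B i ord0 = c *+ (i == ord0) by rewrite mxE eqxx.
have colm i : B i ord_max = c *+ (i == ord_max) by rewrite mxE eqxx.
rewrite (expand_det_col _ ord0) (bigD1 ord0) //= big1 ?addr0; last first.
  by move=> i /negbTE i0; rewrite col0 i0 mul0r.
rewrite col0 eqxx /cofactor expr0 mul1r expr2 -mulrA; congr (_ * _).
rewrite (expand_det_col _ ord_max) (bigD1 ord_max) //= big1 ?addr0; last first.
  move=> i im; rewrite 2!mxE lift0_ord_max colm -lift0_ord_max.
  by rewrite (inj_eq lift_inj) (negbTE im) mul0r.
rewrite 2!mxE lift0_ord_max colm eqxx /cofactor -signr_odd addnn odd_double.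
rewrite expr0 mul1r; congr (_ * \det _); apply/matrixP=> i j; rewrite !mxE.
by rewrite ifN 1?eq_sym ?neq_lift // ifN // -lift0_ord_max (inj_eq lift_inj).
Qed.

(* Multiply [A] by the identity matrix in which the extreme columns are
   replaced by those of the adjugate. *)
Lemma det_mul_desnanot n (A : 'M[R]_n.+2) :
  \det A * (cofactor A ord0 ord0 * cofactor A ord_max ord_max
            - cofactor A ord_max ord0 * cofactor A ord0 ord_max) =
  \det A * (\det A * central_minor A).
Proof.
rewrite [RHS]mulrA -expr2 -det_replace_extreme_cols.
have := @det_replace_cols1 n.+2 ord0 ord_max
          (fun i => \adj A i ord0) (fun i => \adj A i ord_max) isT.
rewrite ![\adj A _ _]mxE => <-.
rewrite -det_mulmx; congr (\det _); apply/matrixP=> i j.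
rewrite [LHS]mxE [RHS]mxE.
have mul_adj k : \sum_j A i j * \adj A j k = \det A *+ (i == k).
  by have := congr1 (fun M : 'M_n.+2 => M i k) (mul_mx_adj A); rewrite !mxE.
case: (eqVneq j ord0) => [->|j0].
  by rewrite -mul_adj; apply: eq_bigr => k _; rewrite [X in _ * X]mxE eqxx.
case: (eqVneq j ord_max) => [->|jm].
  by rewrite -mul_adj; apply: eq_bigr => k _; rewrite [X in _ * X]mxE eqxx.
transitivity (\sum_k A i k * (1%:M : 'M_n.+2) k j).
  by apply: eq_bigr => k _; rewrite [X in _ * X]mxE (negbTE j0) (negbTE jm).
by have := congr1 (fun M : 'M_n.+2 => M i j) (mulmx1 A); rewrite mxE.
Qed.

End DesnanotJacobi.

(* Replacing [A] by ['X + A] makes the determinant regular, so that it can be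
   cancelled before specializing at [0]. *)
Theorem desnanot_jacobi (R : idomainType) n (A : 'M[R]_n.+2) :
  \det A * central_minor A =
  cofactor A ord0 ord0 * cofactor A ord_max ord_max
  - cofactor A ord_max ord0 * cofactor A ord0 ord_max.
Proof.
pose B := char_poly_mx (- A).
have detB0 : \det B != 0 by apply/monic_neq0/char_poly_monic.
have := mulfI detB0 (det_mul_desnanot B) => /esym/(congr1 (horner_eval 0)).
have evalB : map_mx (horner_eval (0 : R)) B = A.
  apply/matrixP=> i j; rewrite !mxE /horner_eval hornerD hornerMn hornerX.
  by rewrite mul0rn add0r hornerN hornerC opprK.
rewrite rmorphM rmorphB !(rmorphM _ (cofactor _ _ _)) /= -!cofactor_map_mx.
rewrite -det_map_mx evalB => <-; congr (_ * _).
by rewrite /central_minor -[in LHS]evalB -!(map_col', map_row') det_map_mx.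
Qed.

Lemma det_sum_rows (R : comNzRingType) n (S : finType)
    (P : 'I_n -> pred S) (f : 'I_n -> S -> 'I_n -> R) :
  \det (\matrix_(i, j) \sum_(s | P i s) f i s j) =
  \sum_(g : {ffun 'I_n -> S} | g \in family P)
    \det (\matrix_(i, j) f i (g i) j).
Proof.
rewrite /determinant exchange_big /=; apply: eq_bigr => s _.
rewrite -big_distrr /=; congr (_ * _).
under eq_bigr do rewrite mxE.
rewrite bigA_distr_big_dep /=; apply: eq_bigr => g _.
by apply: eq_bigr => i _; rewrite mxE.
Qed.

Lemma det_zero_block (R : comNzRingType) n (A : 'M[R]_n) (k : nat) :
    (k < n)%N ->
    (forall i j : 'I_n, (k <= i)%N -> (j <= k)%N -> A i j = 0) ->
  \det A = 0.
Proof.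
move=> kn A0; apply: big1 => s _.
have [/existsP[i /andP[ki si]]|/existsPn noblock] :=
    boolP [exists i : 'I_n, (k <= i)%N && (s i <= k)%N].
  by rewrite (bigD1 i) //= A0 // mul0r mulr0.
have: (#|[set i : 'I_n | (k <= i)%N]| <= #|[set j : 'I_n | (k < j)%N]|)%N.
  rewrite -(card_imset _ (@perm_inj _ s)); apply: subset_leq_card.
  apply/subsetP=> y /imsetP[i]; rewrite inE => ki ->.
  by rewrite inE; have := noblock i; rewrite ki /= -ltnNge.
rewrite leqNgt => /negP[]; apply: proper_card; apply/properP; split.
  by apply/subsetP=> i; rewrite !inE => /ltnW.
by exists (Ordinal kn); rewrite !inE /= ?leqnn ?ltnn.
Qed.

(** * Jacobi-Trudi determinants *)

Definition nonincreasing (f : nat -> nat) : Prop :=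
  forall i, (f i.+1 <= f i)%N.

Lemma nonincreasing_leq f : nonincreasing f ->
  {homo f : i j / (i <= j)%N >-> (j <= i)%N}.
Proof. by apply: homo_leq => // j i k ij jk; apply: leq_trans jk ij. Qed.

Section CompleteSymmetric.

Variables (R : comNzRingType) (w : nat -> R).

(* The complete homogeneous symmetric polynomial [h_k] at
   [w 0, ..., w (M-1)]. *)
Fixpoint hsym (M k : nat) : R :=
  if M is M'.+1 then \sum_(s < k.+1) w M' ^+ (k - s) * hsym M' s
  else (k == 0)%:R.

Definition hsymz M (z : int) : R := if z is Posz k then hsym M k else 0.

Lemma hsym0 M : hsym M 0 = 1.
Proof.
by elim: M => //= M IHM; rewrite big_ord_recl big_ord0 mul1r addr0 IHM.
Qed.

Lemma hsymz_neg M (z : int) : (z < 0)%R -> hsymz M z = 0.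
Proof. by case: z. Qed.

Lemma hsymz0 M : hsymz M 0 = 1.
Proof. exact: hsym0. Qed.

Lemma hsymz_no_variable (z : int) : (0 < z)%R -> hsymz 0 z = 0.
Proof. by case: z => [[]|]. Qed.

Lemma hsymS M k : hsym M.+1 k.+1 = hsym M k.+1 + w M * hsym M.+1 k.
Proof.
rewrite /= big_ord_recr /= subnn mul1r addrC; congr (_ + _).
rewrite mulr_sumr; apply: eq_bigr => s _.
by rewrite mulrA -exprS subSn // -ltnS.
Qed.

Lemma hsymzS M (z : int) :
  hsymz M.+1 z = hsymz M z + w M * hsymz M.+1 (z - 1).
Proof.
case: z => [[|k]|k].
- by rewrite !hsymz0 mulr0 addr0.
- by rewrite (_ : Posz k.+1 - 1 = k); [apply: hsymS | lia].
- by rewrite ![hsymz _ _]hsymz_neg ?mulr0 ?addr0 //; lia.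
Qed.

Lemma hsymz_sum M (a b : nat) (y : int) : (a <= b)%N ->
  hsymz M.+1 (b%:Z + y) =
  \sum_(a <= s < b.+1) w M ^+ (b - s) * hsymz M (s%:Z + y)
  + w M ^+ (b - a).+1 * hsymz M.+1 (a%:Z + y - 1).
Proof.
elim: b => [|b IHb] ab.
  have -> : a = 0%N by lia.
  by rewrite big_nat1 subnn mul1r hsymzS.
have [->|ab'] := eqVneq a b.+1; first by rewrite big_nat1 subnn mul1r hsymzS.
have {}ab : (a <= b)%N by lia.
rewrite hsymzS; have -> : b.+1%:Z + y - 1 = b%:Z + y by lia.
rewrite IHb // [in RHS]big_nat_recr /=; last by lia.
rewrite subnn mul1r mulrDr mulr_sumr mulrA -exprS addrA [X in X + _]addrC.
congr (_ + _ + w M ^+ _ * _); last by lia.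
by apply: eq_big_nat => s sb; rewrite mulrA -exprS subSn //; lia.
Qed.

Definition jtdet r M (lam mu : nat -> nat) : R :=
  \det (\matrix_(i < r, j < r)
          hsymz M ((lam i)%:Z - i%:Z - (mu j)%:Z + j%:Z)).

Lemma jtdet_eq r M lam mu lam' mu' :
    (forall i j, (i < r)%N -> (j < r)%N ->
       lam i + mu' j = lam' i + mu j)%N ->
  jtdet r M lam mu = jtdet r M lam' mu'.
Proof.
move=> same_diff; congr (\det _); apply/matrixP=> i j; rewrite !mxE.
by congr hsymz; have := same_diff i j (ltn_ord i) (ltn_ord j); lia.
Qed.

Lemma jtdet_vanish r M lam mu k :
    nonincreasing lam -> nonincreasing mu -> (k < r)%N -> (lam k < mu k)%N ->
  jtdet r M lam mu = 0.
Proof.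
move=> lam_dec mu_dec kr lk; apply: (det_zero_block kr) => i j ki jk.
rewrite mxE hsymz_neg //; have := nonincreasing_leq lam_dec ki.
by have := nonincreasing_leq mu_dec jk; lia.
Qed.

Lemma jtdet_diag r M lam : nonincreasing lam -> jtdet r M lam lam = 1.
Proof.
move=> lam_dec; rewrite /jtdet -det_tr det_trig.
  by apply: big1 => i _; rewrite !mxE addrAC subrK subrr hsymz0.
apply/is_trig_mxP=> i j ij; rewrite !mxE hsymz_neg //.
by have := nonincreasing_leq lam_dec (ltnW ij); lia.
Qed.

Lemma jtdet_block r s M lam mu :
    (forall i j, (i < s)%N -> (j < r)%N -> lam (r + i) <= mu j)%N ->
  jtdet (r + s) M lam mu =
  jtdet r M lam mu
  * jtdet s M (fun i => lam (r + i)%N) (fun j => mu (r + j)%N).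
Proof.
move=> lam_mu; rewrite {1}/jtdet; set A := (X in \det X).
rewrite -[A]submxK (_ : dlsubmx A = 0) ?det_ublock; last first.
  apply/matrixP=> i j; rewrite !mxE hsymz_neg //=.
  by have := lam_mu i j (ltn_ord i) (ltn_ord j); have := ltn_ord j; lia.
by congr (_ * _); congr (\det _); apply/matrixP=> i j; rewrite !mxE //=;
  congr hsymz; lia.
Qed.

Lemma jtdet_pad r s M lam mu :
    (forall i, (r <= i)%N -> lam i = 0%N) ->
    (forall i, (r <= i)%N -> mu i = 0%N) ->
  jtdet (r + s) M lam mu = jtdet r M lam mu.
Proof.
move=> lam0 mu0; rewrite jtdet_block => [|i j _ _]; last first.
  by rewrite lam0 ?leq_addr.
rewrite [X in _ * X](_ : _ = jtdet s M (fun=> 0%N) (fun=> 0%N)).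
  by rewrite jtdet_diag ?mulr1 // => i.
by apply: jtdet_eq => i j _ _; rewrite lam0 ?mu0 ?leq_addr.
Qed.

Lemma jtdet_rotate r M lam mu B :
    (forall i, (i < r)%N -> (lam i <= B)%N) ->
    (forall i, (i < r)%N -> (mu i <= B)%N) ->
  jtdet r M lam mu =
  jtdet r M (fun i => B - mu (r - i.+1))%N (fun j => B - lam (r - j.+1))%N.
Proof.
move=> lam_B mu_B; pose s : 'S_r := perm (@rev_ord_inj r).
rewrite {1}/jtdet; set A := (X in \det X).
transitivity (\det (row_perm s (col_perm s A))^T).
  rewrite det_tr row_permE col_permE !det_mulmx !det_perm odd_permV mulrCA.
  by rewrite -signr_addb addbb mulr1.
congr (\det _); apply/matrixP=> i j; rewrite !mxE !permE /=; congr hsymz.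
have := ltn_ord i; have := ltn_ord j => jr ir.
by have := lam_B (r - j.+1)%N; have := mu_B (r - i.+1)%N; lia.
Qed.

(* Subtracting from each row a multiple of the next one turns the rows into
   sums over disjoint intervals. *)
Lemma jtdet_row_diff r M lam mu : nonincreasing lam -> lam r = 0%N ->
  jtdet r M.+1 lam mu =
  \det (\matrix_(i < r, j < r)
     \sum_(lam i.+1 <= s < (lam i).+1)
       w M ^+ (lam i - s) * hsymz M (s%:Z - i%:Z - (mu j)%:Z + j%:Z)).
Proof.
move=> lam_dec lam_r.
pose U : 'M[R]_r := \matrix_(i, k) ((i == k)%:R
   - w M ^+ (lam i - lam i.+1).+1 * (k == i.+1 :> nat)%:R).
have detU : \det U = 1.
  rewrite -det_tr det_trig; last first.
    apply/is_trig_mxP => i j ij; rewrite !mxE.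
    have -> : (j == i) = false by apply/negbTE; rewrite -val_eqE /=; lia.
    have -> : (i == j.+1 :> nat) = false by lia.
    by rewrite mulr0 subr0.
  apply: big1 => i _; rewrite !mxE eqxx.
  by have -> : (i == i.+1 :> nat) = false; [lia | rewrite mulr0 subr0].
rewrite /jtdet -[LHS]mul1r -detU -det_mulmx; congr (\det _).
apply/matrixP=> i j; rewrite !mxE; set y := (- i%:Z - (mu j)%:Z + j%:Z).
transitivity (hsymz M.+1 ((lam i)%:Z + y) -
  w M ^+ (lam i - lam i.+1).+1 * hsymz M.+1 ((lam i.+1)%:Z + y - 1)).
  under eq_bigr => k _ do rewrite !mxE mulrBl -mulrA.
  rewrite big_split /= sumrN -mulr_sumr; congr (_ - _ * _).
    rewrite (bigD1 i) //= big1 ?addr0 ?eqxx ?mul1r => [|k ki].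
      by congr hsymz; rewrite /y; lia.
    by rewrite eq_sym (negbTE ki) mul0r.
  have [ir|ir] := ltnP i.+1 r.
    rewrite (bigD1 (Ordinal ir)) //= big1 ?addr0 ?eqxx ?mul1r => [|k ki].
      by congr hsymz; rewrite /y; lia.
    by rewrite -[i.+1]/(val (Ordinal ir)) val_eqE (negbTE ki) mul0r.
  have eir : i.+1 = r by have := ltn_ord i; lia.
  rewrite hsymz_neg; last by rewrite /y eir lam_r; have := ltn_ord j; lia.
  by apply: big1 => k _; rewrite eir (ltn_eqF (ltn_ord k)) mul0r.
rewrite (hsymz_sum _ _ (lam_dec i)) addrK; apply: eq_bigr => s _.
by congr (_ * hsymz _ _); rewrite /y; lia.
Qed.

End CompleteSymmetric.

Lemma jtdet_condensation (R : idomainType) (w : nat -> R) r M lam mu :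
  let lamS i := lam i.+1 in let muS j := mu j.+1 in
  jtdet w r.+2 M lam mu * jtdet w r M lamS muS =
  jtdet w r.+1 M lamS muS * jtdet w r.+1 M lam mu
  - jtdet w r.+1 M (succn \o lam) muS * jtdet w r.+1 M lamS (succn \o mu).
Proof.
move=> lamS muS; rewrite [jtdet w r.+2 _ _ _]/jtdet; set A := (X in \det X).
have bump0 i : bump 0 i = i.+1 by [].
have bump_ord n (i : 'I_n) : bump n i = i.
  by rewrite /bump leqNgt ltn_ord.
rewrite (_ : jtdet w r M lamS muS = central_minor A); last first.
  congr (\det _); apply/matrixP=> i j; rewrite !mxE /= !bump_ord !bump0.
  by congr hsymz; rewrite /lamS /muS; lia.
rewrite desnanot_jacobi /cofactor /= !addn0 !add0n expr0 mul1r.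
rewrite -[(-1) ^+ (r.+1 + r.+1)]signr_odd addnn odd_double expr0 mul1r.
rewrite [X in _ - X]mulrACA -expr2 sqrr_sign mul1r.
congr (_ * _ - _ * _); congr (\det _); apply/matrixP=> i j;
  by rewrite !mxE /= ?bump_ord ?bump0; congr hsymz; rewrite /lamS /muS; lia.
Qed.

Lemma jtdet0 (R : comNzRingType) (w : nat -> R) r lam mu :
    nonincreasing mu -> (forall i, mu i <= lam i)%N ->
  jtdet w r 0 lam mu = [forall i : 'I_r, lam i <= mu i]%N%:R.
Proof.
move=> mu_dec mu_lam; rewrite /jtdet det_trig; last first.
  apply/is_trig_mxP => i j ij; rewrite mxE hsymz_no_variable //.
  by have := mu_lam i; have := nonincreasing_leq mu_dec (ltnW ij); lia.
transitivity (\prod_(i < r) (lam i <= mu i)%N%:R : R).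
  apply: eq_bigr => i _; rewrite mxE; have := mu_lam i.
  case: (leqP (lam i)) => [lam_mu|mu_lt] mu_le; last first.
    by rewrite hsymz_no_variable //; lia.
  by rewrite (_ : _ + i%:Z = 0) ?hsymz0 //; lia.
have [/forallP lam_mu|/forallPn[i lam_mu]] :=
  boolP [forall i : 'I_r, lam i <= mu i]%N.
  by apply: big1 => i _; rewrite lam_mu.
by rewrite (bigD1 i) //= (negbTE lam_mu) mul0r.
Qed.

Section Interlacing.

Variables r K : nat.
Implicit Type nu : {ffun 'I_r -> 'I_K.+1}.

Definition ffun_part nu (i : nat) : nat :=
  if insub i is Some o then nu o else 0%N.

Lemma ffun_partE nu (i : 'I_r) : ffun_part nu i = nu i.
Proof. by rewrite /ffun_part valK. Qed.

Lemma ffun_part_out nu i : (r <= i)%N -> ffun_part nu i = 0%N.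
Proof. by move=> ri; rewrite /ffun_part insubN // -leqNgt. Qed.

Definition interlace (lam : nat -> nat) nu : bool :=
  [forall i : 'I_r, lam i.+1 <= nu i <= lam i]%N.

Lemma interlace_nonincreasing lam nu :
  interlace lam nu -> nonincreasing (ffun_part nu).
Proof.
move=> /forallP interl i; have [ir|ir] := ltnP i.+1 r; last first.
  by rewrite ffun_part_out.
rewrite (ffun_partE nu (Ordinal ir)) (ffun_partE nu (Ordinal (ltnW ir))).
have /andP[_ nu_le] := interl (Ordinal ir).
have /andP[nu_ge _] := interl (Ordinal (ltnW ir)).
exact: leq_trans nu_le nu_ge.
Qed.

Lemma jtdetS (R : comNzRingType) (w : nat -> R) M lam mu :
    nonincreasing lam -> lam r = 0%N -> (lam 0 <= K)%N ->
  jtdet w r M.+1 lam mu = \sum_(nu | interlace lam nu)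
    w M ^+ (\sum_(i < r) (lam i - nu i)) * jtdet w r M (ffun_part nu) mu.
Proof.
move=> lam_dec lam_r lam0K; rewrite jtdet_row_diff //.
have lamK i : (lam i <= K)%N by apply: leq_trans (nonincreasing_leq _ _) lam0K.
pose P (i : 'I_r) := [pred s : 'I_K.+1 | (lam i.+1 <= s <= lam i)%N].
transitivity (\det (\matrix_(i < r, j < r) \sum_(s : 'I_K.+1 | P i s)
     w M ^+ (lam i - s) * hsymz w M (s%:Z - i%:Z - (mu j)%:Z + j%:Z))).
  congr (\det _); apply/matrixP=> i j; rewrite !mxE.
  rewrite (big_nat_widen _ _ K.+1) ?ltnS ?lamK //.
  rewrite (big_nat_widenl _ 0) // big_mkord; apply: eq_bigl => s /=.
  by rewrite ltnS andbC.
rewrite det_sum_rows; apply: eq_big => [nu|nu _].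
  by apply/familyP/forallP => interl i; have := interl i; rewrite ?inE.
rewrite -prodrXr /jtdet.
pose dg : 'rV[R]_r := \row_i w M ^+ (lam i - nu i).
rewrite [X in X * _](_ : _ = \det (diag_mx dg)); last first.
  by rewrite det_diag; apply: eq_bigr => i _; rewrite mxE.
rewrite -det_mulmx; congr (\det _); apply/matrixP=> i j.
by rewrite mul_diag_mx !mxE ffun_partE.
Qed.

Record skew_shape (lam mu : nat -> nat) : Prop := SkewShape {
  outer_nonincreasing : nonincreasing lam;
  inner_nonincreasing : nonincreasing mu;
  inner_leq_outer : forall i, (mu i <= lam i)%N;
  outer_height : lam r = 0%N;
  outer_width : (lam 0 <= K)%N
}.

Lemma outer_leq_width lam mu i : skew_shape lam mu -> (lam i <= K)%N.
Proof.
case=> lam_dec _ _ _; apply: leq_trans; exact: nonincreasing_leq lam_dec _ _ _.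
Qed.

Lemma interlace_shape lam mu nu :
    skew_shape lam mu -> interlace lam nu ->
    (forall i : 'I_r, mu i <= nu i)%N ->
  skew_shape (ffun_part nu) mu.
Proof.
case=> lam_dec mu_dec mu_lam lam_r lam_K nu_lam mu_nu; split=> //.
- exact: interlace_nonincreasing nu_lam.
- move=> i; have [ir|ri] := ltnP i r.
    by rewrite (ffun_partE nu (Ordinal ir)); apply: (mu_nu (Ordinal ir)).
  have := mu_lam i; have := nonincreasing_leq lam_dec ri.
  by rewrite lam_r ffun_part_out //; lia.
- by rewrite ffun_part_out.
- have [r0|r0] := posnP r; first by rewrite ffun_part_out ?r0.
  by rewrite (ffun_partE nu (Ordinal r0)) -ltnS.
Qed.

End Interlacing.

(** * Tableaux in a box *)

Section BoxTableaux.

Variables (R : comNzRingType) (w : nat -> R) (r K N : nat).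

Local Notation box := ('I_r * 'I_K)%type.
Local Notation filling := {ffun box -> 'I_N.+1}.
Implicit Types (lam mu : nat -> nat) (T : filling) (x : box).
Implicit Type nu : {ffun 'I_r -> 'I_K.+1}.

Definition in_shape lam mu x : bool := (mu x.1 <= x.2 < lam x.1)%N.

(* Tableaux of shape [lam / mu] with entries less than [M], extended by [0] to
   the whole box; rows and columns are numbered from [0]. *)
Definition tableau M lam mu T : bool :=
  [&& [forall x,
         if in_shape lam mu x then (T x < M)%N else (T x == 0 :> nat)%N],
      [forall i, [forall j, [forall j',
        [&& in_shape lam mu (i, j), in_shape lam mu (i, j') & (j < j')%N]
        ==> (T (i, j) <= T (i, j'))%N]]]
    & [forall j, [forall i, [forall i',
        [&& in_shape lam mu (i, j), in_shape lam mu (i', j) & (i < i')%N]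
        ==> (T (i, j) < T (i', j))%N]]]].

Record is_tableau M lam mu T : Prop := IsTableau {
  tableau_lt : forall x, in_shape lam mu x -> (T x < M)%N;
  tableau_out : forall x, ~~ in_shape lam mu x -> T x = 0 :> nat;
  tableau_row : forall i j j', in_shape lam mu (i, j) ->
    in_shape lam mu (i, j') -> (j < j')%N -> (T (i, j) <= T (i, j'))%N;
  tableau_col : forall j i i', in_shape lam mu (i, j) ->
    in_shape lam mu (i', j) -> (i < i')%N -> (T (i, j) < T (i', j))%N
}.

Lemma tableauP M lam mu T :
  reflect (is_tableau M lam mu T) (tableau M lam mu T).
Proof.
apply: (iffP and3P) => [[/forallP entries /forallP rows /forallP cols]|].
  split.
  - by move=> x xs; have := entries x; rewrite xs.
  - by move=> x xs; have := entries x; rewrite (negbTE xs) => /eqP.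
  - move=> i j j' s s' jj; have /forallP/(_ j)/forallP/(_ j') := rows i.
    by rewrite s s' jj.
  - move=> j i i' s s' ii; have /forallP/(_ i)/forallP/(_ i') := cols j.
    by rewrite s s' ii.
case=> lt out rows cols; split.
- by apply/forallP=> x; case: ifPn => [/lt|/out ->].
- apply/forallP=> i; apply/forallP=> j; apply/forallP=> j'.
  by apply/implyP=> /and3P[]; apply: rows.
- apply/forallP=> j; apply/forallP=> i; apply/forallP=> i'.
  by apply/implyP=> /and3P[]; apply: cols.
Qed.

Definition tableau_sum M lam mu : R :=
  \sum_(T | tableau M lam mu T) \prod_(x | in_shape lam mu x) w (T x).

Lemma tableau_sum0 lam mu :
  tableau_sum 0 lam mu = [forall x, ~~ in_shape lam mu x]%:R.
Proof.
have [/forallP empty|/forallPn[x]] := boolP [forall x, ~~ in_shape lam mu x];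
  last first.
  rewrite negbK => xs; apply: big_pred0 => T.
  by apply/negP=> /tableauP/tableau_lt/(_ _ xs).
rewrite /tableau_sum (big_pred1 [ffun=> ord0]) => [|T].
  by rewrite big1 // => x; rewrite (negbTE (empty x)).
apply/tableauP/eqP => [tabT|->].
  apply/ffunP=> x; rewrite ffunE; apply: val_inj.
  by rewrite /= (tableau_out tabT).
by split=> [x|x _|i j j'|j i i']; rewrite ?(negbTE (empty _)) // ffunE.
Qed.

Definition cut M lam mu T : {ffun 'I_r -> 'I_K.+1} :=
  [ffun i : 'I_r => inord (maxn (mu i)
     (\max_(j < K | in_shape lam mu (i, j) && (T (i, j) < M)%N) j.+1))].

Definition glue M lam nu T : filling :=
  [ffun x : box => if (nu x.1 <= x.2 < lam x.1)%N then inord M else T x].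

Definition restrict nu T : filling :=
  [ffun x : box => if (x.2 < nu x.1)%N then T x else ord0].

Section LargestEntry.

Variables (M : nat) (lam mu : nat -> nat).
Hypothesis shape : skew_shape r K lam mu.

Let lamK i : (lam i <= K)%N := outer_leq_width i shape.

Definition cuts T nu : Prop :=
  (forall i : 'I_r, mu i <= nu i <= lam i)%N /\
  (forall x, in_shape lam mu x -> (T x < M)%N = (x.2 < nu x.1)%N).

Lemma cuts_unique T nu nu' : cuts T nu -> cuts T nu' -> nu = nu'.
Proof.
move=> [bnd cut_nu] [bnd' cut_nu']; apply/ffunP=> i; apply: val_inj => /=.
have same_lt j : (mu i <= j < lam i)%N -> (j < nu i)%N = (j < nu' i)%N.
  move=> jb; have jK : (j < K)%N by have := lamK i; lia.
  by rewrite -(cut_nu (i, Ordinal jK)) // -(cut_nu' (i, Ordinal jK)).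
have := same_lt (nu i); have := same_lt (nu' i); have := bnd i; have := bnd' i.
by rewrite !ltnn; lia.
Qed.

Lemma cut_cuts T : tableau M.+1 lam mu T -> cuts T (cut M lam mu T).
Proof.
move=> /tableauP tabT.
have max_le i : (\max_(j < K | in_shape lam mu (i, j) && (T (i, j) < M)) j.+1
                 <= lam i)%N.
  by apply/bigmax_leqP=> j /andP[/andP[_]].
have cutE i : cut M lam mu T i = maxn (mu i)
    (\max_(j < K | in_shape lam mu (i, j) && (T (i, j) < M)%N) j.+1) :> nat.
  rewrite ffunE inordK //; have := max_le i; have := lamK i.
  by have := inner_leq_outer shape i; lia.
split=> [i|[i j] ij].
  by rewrite cutE leq_maxl geq_max (inner_leq_outer shape) max_le.
rewrite cutE /=; apply/idP/idP => [Tij|].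
  by rewrite leq_max (bigmax_sup j) ?orbT // ij Tij.
rewrite leq_max => /orP[j_mu|].
  by move: ij; rewrite /in_shape /=; lia.
rewrite ltnNge; apply: contraR => Tij; apply/bigmax_leqP=> k /andP[ik Tik].
rewrite ltnNge; apply: contra Tij; rewrite leq_eqVlt => /predU1P[/val_inj->//|].
by move=> jk; apply: leq_ltn_trans Tik; apply: (tableau_row tabT).
Qed.

Lemma cut_interlace T : tableau M.+1 lam mu T ->
  interlace lam (cut M lam mu T).
Proof.
move=> tabT; have [cut_bnd cut_lt] := cut_cuts tabT.
move/tableauP: tabT => tabT.
apply/forallP=> i; have := cut_bnd i => /andP[mu_cut ->]; rewrite andbT.
rewrite leqNgt; apply/negP=> lt.
have := lamK i.+1 => lamSK; set c := nat_of_ord (cut _ _ _ _ i) in lt mu_cut.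
have cK : (c < K)%N by lia.
have ir : (i.+1 < r)%N.
  rewrite ltn_neqAle ltn_ord andbT; apply: contraTneq lt => ->.
  by rewrite (outer_height shape).
pose j := Ordinal cK.
have in_row : in_shape lam mu (i, j).
  rewrite /in_shape /= mu_cut /=.
  by apply: leq_trans lt _; apply: outer_nonincreasing shape i.
have in_next_row : in_shape lam mu (Ordinal ir, j).
  rewrite /in_shape /= lt andbT.
  by apply: leq_trans mu_cut; apply: inner_nonincreasing shape i.
have := tableau_col tabT in_row in_next_row (leqnn _).
have := tableau_lt tabT in_next_row.
by have := cut_lt _ in_row; rewrite /= -/c ltnn; lia.
Qed.

Variable nu : {ffun 'I_r -> 'I_K.+1}.
Hypothesis nu_lam : interlace lam nu.
Hypothesis mu_nu : forall i : 'I_r, (mu i <= nu i)%N.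

Let nu_le_lam i : (nu i <= lam i)%N.
Proof. by have /forallP/(_ i)/andP[] := nu_lam. Qed.

Lemma in_shape_part x :
  in_shape (ffun_part nu) mu x = (mu x.1 <= x.2 < nu x.1)%N.
Proof. by rewrite /in_shape ffun_partE. Qed.

Lemma restrict_tableau T : tableau M.+1 lam mu T -> cuts T nu ->
  tableau M (ffun_part nu) mu (restrict nu T).
Proof.
move=> /tableauP tabT [_ cut_nu]; apply/tableauP.
have in_lam x : in_shape (ffun_part nu) mu x -> in_shape lam mu x.
  by rewrite in_shape_part /in_shape; have := nu_le_lam x.1; lia.
have restrictE x : in_shape (ffun_part nu) mu x -> restrict nu T x = T x.
  by rewrite in_shape_part ffunE => /andP[_ ->].
split.
- move=> x xs; rewrite restrictE // cut_nu ?in_lam //.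
  by move: xs; rewrite in_shape_part => /andP[].
- move=> x; rewrite in_shape_part ffunE; case: ltnP => //= x_nu.
  rewrite andbT => xs; apply: (tableau_out tabT); apply: contra xs.
  by case/andP.
- move=> i j j' s s' jj; rewrite !restrictE //.
  by apply: (tableau_row tabT); rewrite ?in_lam.
- move=> j i i' s s' ii; rewrite !restrictE //.
  by apply: (tableau_col tabT); rewrite ?in_lam.
Qed.

Lemma prod_strip (y : R) :
  \prod_(x : box | (nu x.1 <= x.2 < lam x.1)%N) y =
  y ^+ (\sum_(i < r) (lam i - nu i)).
Proof.
rewrite -prodrXr -(pair_big_dep xpredT
  (fun (i : 'I_r) (j : 'I_K) => (nu i <= j < lam i)%N) (fun _ _ => y)) /=.
apply: eq_bigr => i _; rewrite -prodr_const_nat.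
rewrite [RHS](big_nat_widen _ _ K) // [RHS](big_nat_widenl _ 0) // big_mkord.
by apply: eq_bigl => j; rewrite andbC.
Qed.

Hypothesis M_le_N : (M <= N)%N.

Lemma glueE T x :
  glue M lam nu T x = (if (nu x.1 <= x.2 < lam x.1)%N then M else T x) :> nat.
Proof. by rewrite ffunE; case: ifP; rewrite ?inordK. Qed.

Lemma glue_cuts T : tableau M (ffun_part nu) mu T -> cuts (glue M lam nu T) nu.
Proof.
move=> /tableauP tabT; split=> [i|x xs]; first by rewrite mu_nu nu_le_lam.
rewrite glueE; have := xs; rewrite /in_shape => /andP[mu_x ->]; rewrite andbT.
case: (leqP (nu x.1)) => [_|x_nu]; first by rewrite ltnn.
by rewrite (tableau_lt tabT) // in_shape_part mu_x.
Qed.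

Lemma glue_tableau T : tableau M (ffun_part nu) mu T ->
  tableau M.+1 lam mu (glue M lam nu T).
Proof.
move=> /tableauP tabT; apply/tableauP.
have inside x : in_shape lam mu x -> (x.2 < nu x.1)%N ->
    in_shape (ffun_part nu) mu x.
  by rewrite in_shape_part /in_shape => /andP[-> _] ->.
split.
- move=> x xs; rewrite glueE; case: ifP => // x_nu.
  apply: ltnW; rewrite ltnS (tableau_lt tabT) // inside //.
  by move: x_nu xs; rewrite /in_shape; lia.
- move=> x xs; rewrite glueE; case: ifP => x_nu.
    by move: x_nu xs (mu_nu x.1); rewrite /in_shape; lia.
  apply: (tableau_out tabT); move: x_nu xs (mu_nu x.1) (nu_le_lam x.1).
  by rewrite in_shape_part /in_shape; lia.
- move=> i j j' s s' jj; rewrite !glueE /=.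
  have /andP[_ /= ->] := s; have /andP[_ /= ->] := s'; rewrite !andbT.
  case: (leqP (nu i) j) => nu_j; case: (leqP (nu i) j') => nu_j' //.
  + by move: nu_j nu_j'; lia.
  + by apply: ltnW; apply: (tableau_lt tabT); apply: inside.
  + by apply: (tableau_row tabT) => //; apply: inside.
- move=> j i i' s s' ii; rewrite !glueE /=.
  have /andP[_ /= ->] := s; have /andP[_ /= j_lam'] := s'.
  have j_nu : (j < nu i)%N.
    have /forallP/(_ i)/andP[lam_nu _] := nu_lam; apply: leq_trans lam_nu.
    exact: leq_trans (nonincreasing_leq (outer_nonincreasing shape) ii).
  rewrite j_lam' !andbT (ltn_geF j_nu); case: (leqP (nu i') j) => nu_j.
    by apply: (tableau_lt tabT); apply: inside.
  by apply: (tableau_col tabT) => //; apply: inside.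
Qed.

Lemma restrict_glue T : tableau M (ffun_part nu) mu T ->
  restrict nu (glue M lam nu T) = T.
Proof.
move=> /tableauP tabT; apply/ffunP=> x; apply: val_inj.
rewrite ffunE; case: ltnP => x_nu; first by rewrite /= glueE leqNgt x_nu.
by rewrite /= (tableau_out tabT) // in_shape_part ltnNge x_nu andbF.
Qed.

Lemma glue_restrict T : tableau M.+1 lam mu T -> cuts T nu ->
  glue M lam nu (restrict nu T) = T.
Proof.
move=> /tableauP tabT [_ cut_nu]; apply/ffunP=> x; apply: val_inj.
rewrite /= glueE /=; case: ifP => x_nu.
  have /andP[nu_x x_lam] := x_nu.
  have xs : in_shape lam mu x by rewrite /in_shape x_lam (leq_trans (mu_nu _)).
  have := tableau_lt tabT xs; have := cut_nu _ xs.
  by rewrite [RHS]ltnNge nu_x /=; lia.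
rewrite ffunE; case: ltnP => // nu_x; rewrite /= (tableau_out tabT) //.
by move: x_nu nu_x; rewrite /in_shape; lia.
Qed.

Lemma glue_weight T : tableau M (ffun_part nu) mu T ->
  \prod_(x | in_shape lam mu x) w (glue M lam nu T x) =
  w M ^+ (\sum_(i < r) (lam i - nu i))
  * \prod_(x | in_shape (ffun_part nu) mu x) w (T x).
Proof.
move=> tabT; rewrite (bigID (fun x : box => x.2 < nu x.1)%N) /= mulrC.
rewrite -prod_strip; congr (_ * _); apply: eq_big => x.
- by rewrite /in_shape; have := mu_nu x.1; lia.
- by rewrite glueE -leqNgt => /andP[/andP[_ ->] ->].
- by rewrite in_shape_part /in_shape; have := nu_le_lam x.1; lia.
- by case/andP=> _ x_nu; rewrite glueE leqNgt x_nu.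
Qed.

End LargestEntry.

Lemma tableau_sumS M lam mu : (M <= N)%N -> skew_shape r K lam mu ->
  tableau_sum M.+1 lam mu =
  \sum_(nu : {ffun 'I_r -> 'I_K.+1} |
          interlace lam nu && [forall i : 'I_r, (mu i <= nu i)%N])
    w M ^+ (\sum_(i < r) (lam i - nu i)) * tableau_sum M (ffun_part nu) mu.
Proof.
move=> M_le_N shape; rewrite /tableau_sum.
rewrite (partition_big (cut M lam mu)
  (fun nu => interlace lam nu && [forall i : 'I_r, (mu i <= nu i)%N])) /=;
    last first.
  move=> T tabT; rewrite (cut_interlace shape) //=; apply/forallP=> i.
  by have [/(_ i)/andP[]] := cut_cuts shape tabT.
apply: eq_bigr => nu /andP[nu_lam /forallP mu_nu].
have cut_nu T : tableau M.+1 lam mu T -> cut M lam mu T = nu ->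
    cuts M lam mu T nu.
  by move=> tabT <-; apply: cut_cuts.
rewrite (reindex_onto (glue M lam nu) (restrict nu)) /=; last first.
  move=> T /andP[tabT /eqP/(cut_nu _ tabT)]; exact: glue_restrict.
rewrite mulr_sumr; apply: eq_big => [T|T].
  apply/idP/idP => [/andP[/andP[tabT /eqP/(cut_nu _ tabT) cutT] /eqP <-]|tabT].
    exact: restrict_tableau cutT.
  rewrite (glue_tableau shape) // (restrict_glue lam M_le_N tabT) eqxx andbT.
  have cutT := cut_cuts shape (glue_tableau shape nu_lam mu_nu M_le_N tabT).
  exact/eqP/(cuts_unique shape cutT)/glue_cuts.
case/andP=> /andP[tabT /eqP/(cut_nu _ tabT) cutT] /eqP eT.
by rewrite glue_weight // -eT; apply: restrict_tableau cutT.
Qed.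

Theorem jacobi_trudi M lam mu : (M <= N.+1)%N -> skew_shape r K lam mu ->
  tableau_sum M lam mu = jtdet w r M lam mu.
Proof.
elim: M lam => [|M IHM] lam M_le_N shape.
  rewrite tableau_sum0 jtdet0; [|by case: shape..].
  congr (_ %:R); congr nat_of_bool.
  apply/forallP/forallP => [empty i|empty [i j]].
    rewrite leqNgt; apply/negP=> lt.
    have mu_K : (mu i < K)%N by apply: leq_trans lt (outer_leq_width i shape).
    by have := empty (i, Ordinal mu_K); rewrite /in_shape /= leqnn lt.
  by have := empty i; rewrite /in_shape /=; lia.
rewrite tableau_sumS // (@jtdetS _ K); [|by case: shape..].
rewrite [RHS](bigID (fun nu : {ffun 'I_r -> 'I_K.+1} =>
   [forall i : 'I_r, (mu i <= nu i)%N])) /=.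
rewrite [X in _ = _ + X]big1 ?addr0 => [|nu /andP[nu_lam /forallPn[i]]].
  apply: eq_bigr => nu /andP[nu_lam /forallP mu_nu].
  rewrite IHM ?(ltnW M_le_N) //.
  exact: interlace_shape shape _ _.
rewrite -ltnNge -ffun_partE => nu_mu.
rewrite (jtdet_vanish _ _ _ (inner_nonincreasing shape) (ltn_ord i)) ?mulr0 //.
exact: interlace_nonincreasing nu_lam.
Qed.

End BoxTableaux.

(** * Tableaux on a list of cells *)

Lemma mem_diagram lam (x : cell) :
  (x \in diagram lam) = [&& 0 < x.1, 0 < x.2 & x.2 <= part lam x.1]%N.
Proof.
case: x => i j /=; apply/allpairsPdep/and3P => [[i' [j' []]]|[i0 j0 j_lam]].
  by rewrite !mem_iota => i'_lam j'_lam [-> ->]; split; lia.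
exists i, j; rewrite !mem_iota; split=> //; last by lia.
rewrite i0 /= add1n ltnS -[i]prednK // ltnNge; apply/negP=> i_out.
by move: j_lam; rewrite /part nth_default //; lia.
Qed.

Lemma mem_skew lam mu (x : cell) :
  (x \in skew lam mu) =
  [&& 0 < x.1, 0 < x.2 & part mu x.1 < x.2 <= part lam x.1]%N.
Proof. by rewrite mem_filter !mem_diagram; lia. Qed.

Section SchurBox.

Variables (F : fieldType) (q : F) (lam mu : seq nat) (N : nat).
Hypothesis lam_dec : nonincreasing (nth 0%N lam).
Hypothesis mu_dec : nonincreasing (nth 0%N mu).
Hypothesis mu_lam : forall i, (nth 0%N mu i <= nth 0%N lam i)%N.

Local Notation pi := (skew lam mu).
Local Notation box := ('I_(size lam) * 'I_(nth 0%N lam 0))%type.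
Local Notation in_pi := (in_shape (nth 0%N lam) (nth 0%N mu)).

Let shape :
  skew_shape (size lam) (nth 0%N lam 0) (nth 0%N lam) (nth 0%N mu).
Proof. by split=> //; rewrite nth_default. Qed.

Lemma sub_row (y : seq_sub pi) : ((val y).1.-1 < size lam)%N.
Proof.
have := valP y; rewrite mem_skew => /and4P[_ y2 _ y_lam].
rewrite ltnNge; apply/negP=> y_out; move: y_lam.
by rewrite /part nth_default // leqNgt y2.
Qed.

Lemma sub_col (y : seq_sub pi) : ((val y).2.-1 < nth 0%N lam 0)%N.
Proof.
have := valP y; rewrite mem_skew => /and4P[_ y2 _ y_lam].
by apply: leq_trans (outer_leq_width (val y).1.-1 shape); rewrite prednK.
Qed.

Definition box_of (y : seq_sub pi) : box :=
  (Ordinal (sub_row y), Ordinal (sub_col y)).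

Definition cell_of (x : box) : cell := (x.1.+1, x.2.+1).

Lemma box_ofK y : cell_of (box_of y) = val y.
Proof.
have := valP y; rewrite mem_skew => /and4P[y1 y2 _ _].
by rewrite [RHS]surjective_pairing /cell_of /= !prednK.
Qed.

Lemma cell_of_inj : injective cell_of.
Proof. by move=> [i j] [i' j'] [/val_inj-> /val_inj->]. Qed.

Lemma box_of_inj : injective box_of.
Proof. by move=> y z e; apply: val_inj; rewrite -!box_ofK e. Qed.

Lemma mem_cell_of x : (cell_of x \in pi) = in_pi x.
Proof. by rewrite mem_skew /part /in_shape /= ltnS. Qed.

Lemma in_shape_box_of y : in_pi (box_of y).
Proof. by rewrite -mem_cell_of box_ofK; apply: valP. Qed.

Lemma box_of_surj x : in_pi x -> exists y, x = box_of y.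
Proof.
rewrite -mem_cell_of => xs; exists (Sub (cell_of x) xs).
by apply: cell_of_inj; rewrite box_ofK SubK.
Qed.

Definition to_box (T : {ffun seq_sub pi -> 'I_N.+1}) : {ffun box -> 'I_N.+1} :=
  [ffun x => oapp T ord0 (insub (cell_of x))].

Definition of_box (T : {ffun box -> 'I_N.+1}) : {ffun seq_sub pi -> 'I_N.+1} :=
  [ffun y => T (box_of y)].

Lemma to_box_in T y : to_box T (box_of y) = T y.
Proof. by rewrite ffunE box_ofK valK. Qed.

Lemma to_box_out T x : ~~ in_pi x -> to_box T x = ord0.
Proof. by rewrite -mem_cell_of => xs; rewrite ffunE insubN. Qed.

Lemma to_boxK : cancel to_box of_box.
Proof. by move=> T; apply/ffunP=> y; rewrite ffunE to_box_in. Qed.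

Lemma of_boxK T : tableau N.+1 (nth 0%N lam) (nth 0%N mu) T ->
  to_box (of_box T) = T.
Proof.
move=> /tableauP tabT; apply/ffunP=> x.
have [/box_of_surj[y ->]|xs] := boolP (in_pi x).
  by rewrite to_box_in ffunE.
by rewrite to_box_out //; apply: val_inj; rewrite /= (tableau_out tabT).
Qed.

Lemma tableau_to_box T :
  tableau N.+1 (nth 0%N lam) (nth 0%N mu) (to_box T) = semistandard T.
Proof.
apply/tableauP/forallP => [tabT y|semi].
  apply/forallP=> z; rewrite -!to_box_in -!box_ofK.
  have := in_shape_box_of y; have := in_shape_box_of z.
  case: (box_of y) (box_of z) => i j [i' j'] sz sy /=; rewrite !eqSS !ltnS.
  apply/andP; split; apply/implyP=> /andP[/eqP/ord_inj eq_index].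
    by move: sz; rewrite -eq_index => sz; apply: (tableau_row tabT).
  by move: sz; rewrite -eq_index => sz; apply: (tableau_col tabT).
split=> [x _|x xs|i j j' s s'|j i i' s s'].
- exact: ltn_ord.
- by rewrite to_box_out.
- have [[y ey] [z ez]] := (box_of_surj s, box_of_surj s').
  have /forallP/(_ z)/andP[/implyP] := semi y.
  by rewrite -!to_box_in -!box_ofK -ey -ez /= eqxx ltnS => row _ jj; apply: row.
- have [[y ey] [z ez]] := (box_of_surj s, box_of_surj s').
  have /forallP/(_ z)/andP[_ /implyP] := semi y.
  by rewrite -!to_box_in -!box_ofK -ey -ez /= eqxx ltnS => col ii; apply: col.
Qed.

Lemma prod_to_box T :
  \prod_(x | in_pi x) q ^+ to_box T x = q ^+ (\sum_y T y).
Proof.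
rewrite -prodrXr (partition_big box_of in_pi) /= => [|y _]; last first.
  exact: in_shape_box_of.
apply: eq_bigr => _ /box_of_surj[y ->].
by rewrite to_box_in (big_pred1 y) // => z; rewrite (inj_eq box_of_inj).
Qed.

Theorem schur_principal_jtdet :
  schur_principal pi N q =
  jtdet (GRing.exp q) (size lam) N.+1 (nth 0%N lam) (nth 0%N mu).
Proof.
rewrite -(@jacobi_trudi _ _ _ (nth 0%N lam 0) N) //.
rewrite /tableau_sum (reindex_onto to_box of_box) /=; last exact: of_boxK.
apply: eq_big => T; first by rewrite to_boxK eqxx andbT tableau_to_box.
by rewrite prod_to_box.
Qed.

End SchurBox.

(** * The bialternant formula *)

Section Bialternant.

Variables (K : fieldType) (x : nat -> K).
Hypotheses (x_neq0 : forall s, x s != 0) (x_inj : injective x).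

(* Partial fractions of [\prod_s (1 - x s * t)^-1]; the formula remains valid in
   the degrees [-M, ..., -1], where both sides vanish. *)
Lemma hsymz_sum_exp M : exists c : nat -> K, forall z : int, - M%:Z <= z ->
  hsymz x M.+1 z = \sum_(s < M.+1) c s * x s ^ z.
Proof.
have from_bound m (z : int) : - m%:Z <= z -> exists k : nat, z = k%:Z - m%:Z.
  by exists (absz (z + m%:Z)); lia.
elim: M => [|M [c hsymE]].
  exists (fun=> 1) => z /from_bound[k ->]; rewrite big_ord1 mul1r subr0.
  elim: k => [|k IHk]; first by rewrite hsymz0.
  rewrite hsymzS hsymz_no_variable // add0r (_ : k.+1%:Z - 1 = k); last by lia.
  by rewrite IHk exprSz.
pose c' s := c s * x s / (x s - x M.+1).
pose cM := - x M.+1 ^+ M.+1 * \sum_(s < M.+1) c' s * x s ^ (- M.+1%:Z).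
exists (fun s => if (s < M.+1)%N then c' s else cM).
move=> z /from_bound[k ->] {z}; rewrite big_ord_recr /= ltnn.
under eq_bigr => s _ do rewrite ltn_ord.
elim: k => [|k IHk].
  rewrite hsymz_neg // sub0r /cM mulrAC mulNr -exprnN mulfV ?expf_neq0 //.
  by rewrite mulN1r subrr.
have -> : k.+1%:Z - M.+1%:Z = k%:Z - M.+1%:Z + 1 by lia.
rewrite hsymzS addrK IHk hsymE; last by lia.
rewrite mulrDr addrA mulr_sumr -big_split /=; congr (_ + _).
  apply: eq_bigr => s _; rewrite expfzDr // expr1z /c'.
  have : x s - x M.+1 != 0.
    by rewrite subr_eq0 (inj_eq x_inj) (ltn_eqF (ltn_ord s)).
  by move=> *; field.
by rewrite [_ ^ (_ + 1)]expfzDr // expr1z; ring.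
Qed.

Lemma bialternant M lam :
  jtdet x M M lam (fun=> 0%N) * \det (\matrix_(i < M, s < M) x s ^ (- i%:Z)) =
  \det (\matrix_(i < M, s < M) x s ^ ((lam i)%:Z - i%:Z)).
Proof.
case: M => [|M]; first by rewrite /jtdet !det_mx00 mulr1.
have [c hsymE] := hsymz_sum_exp M.
pose alternant (l : nat -> nat) :=
  \matrix_(i < M.+1, s < M.+1) x s ^ ((l i)%:Z - i%:Z).
pose C := \matrix_(s < M.+1, j < M.+1) (c s * x s ^ j%:Z).
have factor l : jtdet x M.+1 M.+1 l (fun=> 0%N) = \det (alternant l) * \det C.
  rewrite -det_mulmx; congr (\det _); apply/matrixP=> i j; rewrite !mxE.
  rewrite hsymE; last by have := ltn_ord i; lia.
  apply: eq_bigr => s _; rewrite !mxE mulrCA -expfzDr //.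
  by congr (_ * _ ^ _); lia.
rewrite factor -mulrA (_ : \matrix_(i, s) _ = alternant (fun=> 0%N)).
  by rewrite [\det C * _]mulrC -factor jtdet_diag ?mulr1.
by apply/matrixP=> i s; rewrite !mxE sub0r.
Qed.

End Bialternant.

Lemma det_Vandermonde_nat (R : comNzRingType) M (y : nat -> R) :
  \det (\matrix_(i < M, s < M) y i ^+ s) =
  \prod_(0 <= j < M) \prod_(0 <= i < j) (y j - y i).
Proof.
rewrite -det_tr (_ : _^T = Vandermonde M (\row_i y i)); last first.
  by apply/matrixP=> s i; rewrite !mxE.
rewrite det_Vandermonde (exchange_big_dep xpredT) //= big_mkord.
apply: eq_bigr => j _; rewrite (big_nat_widen _ _ M) ?(ltnW (ltn_ord j)) //.
by rewrite big_mkord; apply: eq_bigr => i _; rewrite !mxE.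
Qed.


(** * Fat hooks *)

Definition cell_rect (x p y s : nat) : seq cell :=
  [seq (i, j) | i <- iota x.+1 p, j <- iota y.+1 s].

Lemma mem_cell_rect x p y s (z : cell) :
  (z \in cell_rect x p y s) = (x < z.1 <= x + p)%N && (y < z.2 <= y + s)%N.
Proof.
case: z => i j; apply/allpairsP/andP => [[[i' j'] /= []]|[/= i_x j_y]].
  by rewrite !mem_iota => i'_x j'_y [-> ->]; split; lia.
by exists (i, j); rewrite !mem_iota /=; split=> //; lia.
Qed.

Lemma cell_rect_uniq x p y s : uniq (cell_rect x p y s).
Proof.
by apply: allpairs_uniq; rewrite ?iota_uniq // => -[i j] [i' j'] _ _.
Qed.

Lemma big_cell_rect (R : Type) (idx : R) (op : Monoid.com_law idx) x p y s
    (G : cell -> R) :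
  \big[op/idx]_(z <- cell_rect x p y s) G z =
  \big[op/idx]_(0 <= i < p) \big[op/idx]_(0 <= j < s)
    G ((x + i).+1, (y + j).+1).
Proof.
rewrite /cell_rect big_allpairs -[x.+1]addn0 iotaDl big_map /index_iota !subn0.
apply: eq_bigr => i _; rewrite -[y.+1]addn0 iotaDl big_map.
by apply: eq_bigr => j _; rewrite !addSn.
Qed.

Lemma diagram_uniq lam : uniq (diagram lam).
Proof.
apply: allpairs_uniq_dep => [|i _|[i j] [i' j'] _ _ [-> ->] //];
  exact: iota_uniq.
Qed.

Lemma cells_diff_diagram_uniq lam B : uniq (cells_diff (diagram lam) B).
Proof. exact/filter_uniq/diagram_uniq. Qed.

Lemma sum_cell_rect_leg lam x p y s :
    (forall j, (j < s)%N -> conj_part lam (y + j).+1 = (x + p)%N) ->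
  \sum_(z <- cell_rect x p y s) ((conj_part lam z.2)%:Z - z.1%:Z) =
  (s * 'C(p, 2))%N%:Z.
Proof.
move=> col; rewrite big_cell_rect exchange_big /=.
transitivity (\sum_(0 <= j < s) ('C(p, 2))%:Z); last first.
  by rewrite sumr_const_nat subn0 -mulr_natl natz.
apply: eq_big_nat => j /andP[_ js]; rewrite col // -bin2_sum big_nat_rev.
rewrite (big_morph Posz PoszD (erefl _)) /=; apply: eq_big_nat => i ip.
by lia.
Qed.

Section FatHook.

Variables n a b c d : nat.

Definition fat_hook : seq nat :=
  nseq (n + a) (n + b + c)%N ++ nseq d (n + c)%N.

Lemma size_fat_hook : size fat_hook = (n + a + d)%N.
Proof. by rewrite size_cat !size_nseq. Qed.

Lemma nth_fat_hook i : nth 0%N fat_hook i =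
  (if i < n + a then n + b + c else if i < n + a + d then n + c else 0)%N.
Proof.
rewrite nth_cat size_nseq !nth_nseq; case: ltnP => // i_na.
by do ?[case: ltnP => ?]; lia.
Qed.

Lemma conj_fat_hook j : conj_part fat_hook j.+1 =
  ((if j < n + b + c then n + a else 0) + (if j < n + c then d else 0))%N.
Proof.
rewrite /conj_part count_cat !count_nseq.
by do 2!case: ltnP => ?; rewrite ?mul1n ?mul0n.
Qed.

Lemma perm_fat_hook_skew :
  perm_eq (skew fat_hook (nseq a c))
          (cell_rect a (n + d) 0 c ++ cell_rect 0 (n + a + d) c n
           ++ cell_rect 0 (n + a) (n + c) b).
Proof.
apply/allP => -[i j] _ /=.
rewrite !count_cat !count_uniq_mem ?cell_rect_uniq ?cells_diff_diagram_uniq //.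
rewrite mem_skew !mem_cell_rect /part nth_fat_hook nth_nseq /=.
by case: (ltnP i.-1 (n + a)); case: (ltnP i.-1 (n + a + d));
  case: (ltnP i.-1 a); lia.
Qed.

Definition skew_degree : nat :=
  (b * 'C(n + a, 2) + n * 'C(n + a + d, 2) + c * 'C(n + d, 2))%N.

Lemma skew_degreeE :
  \sum_(x <- skew fat_hook (nseq a c)) ((conj_part fat_hook x.2)%:Z - x.1%:Z) =
  skew_degree%:Z.
Proof.
rewrite (perm_big _ perm_fat_hook_skew) !big_cat /= !sum_cell_rect_leg.
  by rewrite /skew_degree !PoszD; ring.
all: by move=> j jc; rewrite conj_fat_hook; do ?[case: ltnP => ?]; lia.
Qed.

(* Row lengths and column lengths are constant on each of these rectangles. *)
Lemma perm_fat_hook_diff :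
  perm_eq (cells_diff (diagram fat_hook) (skew (nseq (n + a) c) (nseq n c)))
          (cell_rect 0 (n + a) (n + c) b ++ cell_rect 0 n 0 (n + c)
           ++ cell_rect n a c n ++ cell_rect (n + a) d 0 (n + c)).
Proof.
apply/allP => -[i j] _ /=.
rewrite !count_cat !count_uniq_mem ?cell_rect_uniq ?cells_diff_diagram_uniq //.
rewrite mem_filter mem_skew mem_diagram !mem_cell_rect /part nth_fat_hook.
rewrite !nth_nseq /=.
by case: (ltnP i.-1 (n + a)); case: (ltnP i.-1 (n + a + d));
  case: (ltnP i.-1 n); lia.
Qed.

End FatHook.

(** * Products of q-numbers *)

Lemma big_nat_shift (R : Type) (idx : R) (op : R -> R -> R) p s
    (G : nat -> R) :
  \big[op/idx]_(p <= i < p + s) G i = \big[op/idx]_(0 <= i < s) G (p + i)%N.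
Proof.
rewrite -{1}[p]add0n big_addn addKn; apply: eq_bigr => i _.
by rewrite addnC.
Qed.

Lemma prod_pairs_cat (R : comNzRingType) p s (G : nat -> nat -> R) :
  \prod_(0 <= j < p + s) \prod_(0 <= i < j) G i j =
  \prod_(0 <= j < p) \prod_(0 <= i < j) G i j
  * \prod_(0 <= j < s) \prod_(0 <= i < j) G (p + i)%N (p + j)%N
  * \prod_(0 <= i < p) \prod_(0 <= j < s) G i (p + j)%N.
Proof.
rewrite (big_cat_nat (leq0n p) (leq_addr s p)) /= -mulrA; congr (_ * _).
rewrite big_nat_shift [X in _ * X]exchange_big -big_split /=.
apply: eq_bigr => j _; rewrite (big_cat_nat (leq0n p) (leq_addr j p)) /= mulrC.
by rewrite big_nat_shift.
Qed.

Section PrincipalSpecialization.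

Variables (K : fieldType) (q : K).
Hypothesis q_expS_neq1 : forall k, q ^+ k.+1 != 1.

Definition qone k : K := 1 - q ^+ k.+1.
Definition qfact k : K := \prod_(i < k) qone i.
Definition qsuper k : K := \prod_(i < k) qfact i.
Definition qrect x p s : K :=
  \prod_(0 <= i < p) \prod_(0 <= j < s) qone (x + i + j).

Lemma qone_neq0 k : qone k != 0.
Proof. by rewrite subr_eq0 eq_sym q_expS_neq1. Qed.

Lemma qfact_neq0 k : qfact k != 0.
Proof. by apply/prodf_neq0 => i _; apply: qone_neq0. Qed.

Lemma qsuper_neq0 k : qsuper k != 0.
Proof. by apply/prodf_neq0 => i _; apply: qfact_neq0. Qed.

Lemma qrect_neq0 x p s : qrect x p s != 0.
Proof.
rewrite prodf_seq_neq0; apply/allP => i _ /=.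
by rewrite prodf_seq_neq0; apply/allP => j _ /=; apply: qone_neq0.
Qed.

Lemma exprz_sub_qone (z : int) k : q != 0 ->
  q ^ z - q ^ (z + k.+1%:Z) = q ^ z * qone k.
Proof. by move=> q_neq0; rewrite expfzDr // -exprnP /qone mulrBr mulr1. Qed.

Lemma qfactS k : qfact k.+1 = qfact k * qone k.
Proof. by rewrite /qfact big_ord_recr. Qed.

Lemma qsuperS k : qsuper k.+1 = qsuper k * qfact k.
Proof. by rewrite /qsuper big_ord_recr. Qed.

Lemma qfact0 : qfact 0 = 1. Proof. exact: big_ord0. Qed.

Lemma qsuper0 : qsuper 0 = 1. Proof. exact: big_ord0. Qed.

Lemma qrect0p x s : qrect x 0 s = 1. Proof. by rewrite /qrect big_nil. Qed.

Lemma qrectp0 x p : qrect x p 0 = 1.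
Proof. by apply: big1 => i _; rewrite big_nil. Qed.

Lemma qrectC x p s : qrect x p s = qrect x s p.
Proof.
rewrite /qrect exchange_big; apply: eq_bigr => j _; apply: eq_bigr => i _.
by rewrite addnAC.
Qed.

Lemma qfactD x s :
  qfact (x + s) = qfact x * \prod_(0 <= j < s) qone (x + j).
Proof.
elim: s => [|s IHs]; first by rewrite big_nil addn0 mulr1.
by rewrite addnS qfactS IHs big_nat_recr //= mulrA.
Qed.

Lemma qrectE x p s y y1 y2 :
    (x + p + s = y)%N -> (x + p = y1)%N -> (x + s = y2)%N ->
  qrect x p s = qsuper y * qsuper x / (qsuper y1 * qsuper y2).
Proof.
move=> <- <- <-; elim: p => [|p IHp].
  by rewrite qrect0p addn0; field; rewrite !qsuper_neq0.
rewrite /qrect big_nat_recr //= -/(qrect x p s) IHp addnS addSn !qsuperS.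
have -> : \prod_(0 <= j < s) qone (x + p + j) =
          qfact (x + p + s) / qfact (x + p).
  by rewrite qfactD mulrC mulKf ?qfact_neq0.
by field; rewrite !(qsuper_neq0, qfact_neq0).
Qed.

Lemma qexp_inj : q != 0 -> injective (GRing.exp q).
Proof.
move=> q_neq0; suff lt_neq i j : (i < j)%N -> q ^+ i != q ^+ j.
  move=> i j; case: (ltngtP i j) => // /lt_neq/eqP exp_neq exp_eq.
    by case: exp_neq.
  by case: exp_neq; rewrite exp_eq.
move=> ij; apply/eqP=> exp_eq; case/eqP: (q_expS_neq1 (j - i.+1)).
apply: (mulfI (expf_neq0 i q_neq0)); rewrite mulr1 -exprD exp_eq.
by congr (q ^+ _); lia.
Qed.

Lemma hsym_qexp M k :
  hsym (GRing.exp q) M.+1 k = qfact (M + k) / (qfact M * qfact k).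
Proof.
elim: M k => [|M IHM].
  elim=> [|k IHk]; first by rewrite hsym0 !qfact0 mulr1 divr1.
  rewrite hsymS IHk /= !add0n qfact0 !mul1r add0r.
  by rewrite !divff ?qfact_neq0.
elim=> [|k IHk].
  by rewrite hsym0 qfact0 addn0 mulr1 divff ?qfact_neq0.
rewrite hsymS IHk IHM !(addSn, addnS) !qfactS.
have := qfact_neq0 M; have := qfact_neq0 k; have := qone_neq0 M.
have := qone_neq0 k; rewrite /qone !exprS !exprD => *; field.
by apply/and4P; split.
Qed.

Definition weyl_factor (lam : nat -> nat) i j : K :=
  qone (lam i - lam j + (j - i.+1)) / qone (j - i.+1).

(* The q-analogue of Weyl's dimension formula. *)
Theorem jtdet_qexp_straight M lam : q != 0 -> nonincreasing lam ->
  jtdet (GRing.exp q) M M lam (fun=> 0%N) =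
  q ^+ (\sum_(0 <= j < M) j * lam j)
  * \prod_(0 <= j < M) \prod_(0 <= i < j) weyl_factor lam i j.
Proof.
move=> q_neq0 lam_dec.
have alternantE (l : nat -> int) :
    \det (\matrix_(i < M, s < M) (q ^+ s) ^ l i) =
    \prod_(0 <= j < M) \prod_(0 <= i < j) (q ^ l j - q ^ l i).
  rewrite -det_Vandermonde_nat; congr (\det _); apply/matrixP=> i s.
  by rewrite !mxE exprnP exprzAC.
have := bialternant (fun s => expf_neq0 s q_neq0) (qexp_inj q_neq0) M lam.
rewrite (alternantE (fun i => - i%:Z)).
rewrite (alternantE (fun i => (lam i)%:Z - i%:Z)).
set den := \prod_(0 <= j < M) _ => alternant_ratio.
have den_neq0 : den != 0.
  rewrite prodf_seq_neq0; apply/allP => j _ /=; rewrite prodf_seq_neq0.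
  apply/allP => i /=; rewrite mem_index_iota => /andP[_ ij].
  rewrite (_ : - i%:Z = - j%:Z + (j - i.+1).+1%:Z); last by lia.
  by rewrite exprz_sub_qone // mulf_neq0 ?expfz_neq0 ?qone_neq0.
apply: (mulIf den_neq0); rewrite alternant_ratio /den -prodrXr -!big_split /=.
apply: eq_big_nat => j _; rewrite mulnC exprM.
rewrite -[in X in _ ^+ X](subn0 j) -prodr_const_nat -!big_split /=.
apply: eq_big_nat => i /andP[_ ij].
have lam_ij := nonincreasing_leq lam_dec (ltnW ij).
rewrite (_ : (lam i)%:Z - _ =
  (lam j)%:Z - j%:Z + (lam i - lam j + (j - i.+1)).+1%:Z); last by lia.
rewrite (_ : - i%:Z = - j%:Z + (j - i.+1).+1%:Z); last by lia.
rewrite !exprz_sub_qone // expfzDr // -exprnP /weyl_factor; field.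
by rewrite qone_neq0.
Qed.

(** * Condensation of skew fat hooks *)

Definition skew_det M n a b c d : K :=
  jtdet (GRing.exp q) (n + a + d) M
    (nth 0%N (fat_hook n a b c d)) (nth 0%N (nseq a c)).

(* The value of [skew_det] up to a power of [q], where [m] is the number of
   variables minus the number of rows. *)
Definition skew_form m n a b c d : K :=
  qrect (n + d + m) b a * qrect (n + a + m) d c * qrect m n (n + a + b + c + d)
  * (qrect c n a / qrect 0 n a)
  / (qrect 0 (n + a) b * qrect (a + b + d) n (n + c) * qrect (b + d) a n
     * qrect 0 d (n + c)).

Definition skew_closed m n a b c d : K :=
  q ^+ skew_degree n a b c d * skew_form m n a b c d.

Lemma skew_form_neq0 m n a b c d : skew_form m n a b c d != 0.
Proof. by rewrite /skew_form ?(mulf_neq0, invr_neq0, qrect_neq0). Qed.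

Local Notation F := qsuper.

Lemma skew_form_qsuper m n a b c d :
  skew_form m n a b c d =
  F (n + a + b + d + m) * F (n + a + c + d + m) * F (n + d + m) * F (n + a + m)
    * F (n + n + a + b + c + d + m) * F m * F b * F c * F n * F a * F d
    * F (n + a + c) * F (n + b + d) * F (n + a + b + c + d)
  / (F (n + a + d + m) ^+ 2 * F (n + b + d + m) * F (n + a + c + m)
     * F (n + a + b + c + d + m) * F (n + m) * F (a + c) * F (b + d)
     * F (n + a + b) * F (n + c + d) * F (n + n + a + b + c + d)).
Proof.
rewrite /skew_form.
rewrite (@qrectE (n + d + m) b a (n + a + b + d + m) (n + b + d + m)
                 (n + a + d + m)); try lia.
rewrite (@qrectE (n + a + m) d c (n + a + c + d + m) (n + a + d + m)
                 (n + a + c + m)); try lia.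
rewrite (@qrectE m n (n + a + b + c + d) (n + n + a + b + c + d + m) (n + m)
                 (n + a + b + c + d + m)); try lia.
rewrite (@qrectE c n a (n + a + c) (n + c) (a + c)); try lia.
rewrite (@qrectE 0 n a (n + a) n a); try lia.
rewrite (@qrectE 0 (n + a) b (n + a + b) (n + a) b); try lia.
rewrite (@qrectE (a + b + d) n (n + c) (n + n + a + b + c + d) (n + a + b + d)
                 (n + a + b + c + d)); try lia.
rewrite (@qrectE (b + d) a n (n + a + b + d) (a + b + d) (n + b + d)); try lia.
rewrite (@qrectE 0 d (n + c) (n + c + d) d (n + c)); try lia.
by rewrite qsuper0; field; rewrite !qsuper_neq0.
Qed.

(* With [Z = q^z.+1], [W = q^w.+1], [V = q^v.+1] this is the identity
   [V (1 - Z) (1 - W) = (1 - Z V) (1 - W V) - (1 - Z W V) (1 - V)]. *)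
Lemma qone_condensation z w v (L A B : K) :
    A * (qone z * qone w) = L * (qone (z + v).+1 * qone (w + v).+1) ->
    B * (qone z * qone w) = L * (qone (z + w + v).+2 * qone v) ->
  q ^+ v.+1 * L = A - B.
Proof.
move=> eA eB; have zw : qone z * qone w != 0 by rewrite mulf_neq0 ?qone_neq0.
apply: (mulIf zw); rewrite [RHS]mulrBl eA eB /qone !exprS !exprD; ring.
Qed.

Lemma skew_form_condensation m n a b c d :
  q ^+ n.+1 * (skew_form m n.+1 a.+1 b c d.+1 * skew_form m.+2 n.+1 a b c d) =
  skew_form m.+1 n.+1 a b c d.+1 * skew_form m.+1 n.+1 a.+1 b c d
  - skew_form m.+1 n.+2 a b c d * skew_form m.+1 n a.+1 b c d.+1.
Proof.
have nonzero := (qsuper_neq0, qfact_neq0, qone_neq0).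
apply: (@qone_condensation m (n + a + b + c + d).+1).
- have -> : (m + n = n + m)%N by lia.
  have -> : ((n + a + b + c + d).+1 + n = (n + n + a + b + c + d).+1)%N by lia.
  rewrite !skew_form_qsuper !(addSn, addnS) ?(qsuperS, qfactS).
  by field; rewrite ?nonzero.
- have -> : (m + (n + a + b + c + d).+1 + n =
             (n + n + a + b + c + d + m).+1)%N by lia.
  rewrite !skew_form_qsuper !(addSn, addnS) ?(qsuperS, qfactS).
  by field; rewrite ?nonzero.
Qed.

Lemma skew_closed_condensation m n a b c d :
  skew_closed m n.+1 a.+1 b c d.+1 * skew_closed m.+2 n.+1 a b c d =
  skew_closed m.+1 n.+1 a b c d.+1 * skew_closed m.+1 n.+1 a.+1 b c d
  - skew_closed m.+1 n.+2 a b c d * skew_closed m.+1 n a.+1 b c d.+1.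
Proof.
have mulq x y (u v : K) : q ^+ x * u * (q ^+ y * v) = q ^+ (x + y) * (u * v).
  by rewrite exprD mulrACA.
rewrite /skew_closed !mulq.
set e := (skew_degree n.+1 a b c d.+1 + skew_degree n.+1 a.+1 b c d)%N.
rewrite (_ : (_ + skew_degree n a.+1 b c d.+1)%N = e); last first.
  by rewrite /e /skew_degree !(addSn, addnS) !(binS, bin1, bin0); lia.
rewrite (_ : (_ + skew_degree n.+1 a b c d)%N = (e + n.+1)%N); last first.
  by rewrite /e /skew_degree !(addSn, addnS) !(binS, bin1, bin0); lia.
by rewrite exprD -mulrA skew_form_condensation mulrBr.
Qed.

Lemma skew_det_condensation M n a b c d :
  skew_det M n.+1 a.+1 b c d.+1 * skew_det M n.+1 a b c d =
  skew_det M n.+1 a b c d.+1 * skew_det M n.+1 a.+1 b c d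
  - skew_det M n.+2 a b c d * skew_det M n a.+1 b c d.+1.
Proof.
rewrite /skew_det !(addSn, addnS).
set lam := nth 0%N (fat_hook n.+1 a.+1 b c d.+1).
set mu := nth 0%N (nseq a.+1 c).
transitivity (jtdet (GRing.exp q) (n + a + d).+3 M lam mu *
              jtdet (GRing.exp q) (n + a + d).+1 M
                (fun i => lam i.+1) (fun j => mu j.+1)).
  congr (_ * _); apply: jtdet_eq => i j ir jr.
  by rewrite /lam /mu !nth_fat_hook !nth_nseq; do ?[case: ltnP => ?]; lia.
rewrite jtdet_condensation; congr (_ * _ - _ * _);
  apply: jtdet_eq => i j ir jr; rewrite /lam /mu /comp !nth_fat_hook !nth_nseq;
  by do ?[case: ltnP => ?]; lia.
Qed.

Lemma skew_det_disjoint M a b c d :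
  skew_det M 0 a b c d = skew_det M 0 0 0 b a * skew_det M 0 0 0 c d.
Proof.
rewrite /skew_det !add0n jtdet_block => [|i j id ja].
  by congr (_ * _); apply: jtdet_eq => i j ir jr;
    rewrite !nth_fat_hook !nth_nseq; do ?[case: ltnP => ?]; lia.
by rewrite nth_fat_hook nth_nseq ja; do ?[case: ltnP => ?]; lia.
Qed.

Lemma skew_det_rotate M n a b c : skew_det M n a b c 0 = skew_det M n 0 c b a.
Proof.
rewrite /skew_det !addn0.
rewrite (@jtdet_rotate _ _ _ _ _ _ (n + b + c)) => [|i ir|i ir].
- apply: jtdet_eq => i j ir jr.
  by rewrite !nth_fat_hook !nth_nseq; do ?[case: ltnP => ?]; lia.
- by rewrite nth_fat_hook; do ?[case: ltnP => ?]; lia.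
- by rewrite nth_nseq; do ?[case: ltnP => ?]; lia.
Qed.

Lemma skew_form_disjoint m a b c d :
  skew_form m 0 a b c d =
  skew_form (d + m) 0 0 0 b a * skew_form (a + m) 0 0 0 c d.
Proof.
rewrite /skew_form !(add0n, addn0) !(qrect0p, qrectp0).
rewrite (qrectC (d + m) a b) (qrectC 0 a b).
by field; rewrite !qrect_neq0 oner_neq0.
Qed.

Lemma skew_form_rotate m n a b c :
  skew_form m n a b c 0 = skew_form m n 0 c b a.
Proof.
rewrite !skew_form_qsuper !(addn0, add0n) qsuper0.
have -> : (n + n + c + b + a = n + n + a + b + c)%N by lia.
have -> : (n + c + b + a = n + a + b + c)%N by lia.
have -> : (n + b + a = n + a + b)%N by lia.
have -> : (n + c + a = n + a + c)%N by lia.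
have -> : (c + a = a + c)%N by lia.
by field; rewrite !qsuper_neq0.
Qed.

Lemma weyl_factor_shift lam x i j :
  weyl_factor lam (x + i) (x + j) = weyl_factor (fun k => lam (x + k)%N) i j.
Proof. by rewrite /weyl_factor -addnS subnDl. Qed.

Lemma prod_weyl_factor_cat lam p s :
  \prod_(0 <= j < p + s) \prod_(0 <= i < j) weyl_factor lam i j =
  \prod_(0 <= j < p) \prod_(0 <= i < j) weyl_factor lam i j
  * \prod_(0 <= j < s) \prod_(0 <= i < j)
      weyl_factor (fun k => lam (p + k)%N) i j
  * \prod_(0 <= i < p) \prod_(0 <= j < s) weyl_factor lam i (p + j).
Proof.
rewrite prod_pairs_cat; congr (_ * _ * _).
by apply: eq_bigr => j _; apply: eq_bigr => i _; rewrite weyl_factor_shift.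
Qed.

Lemma prod_weyl_factor_const lam p x :
    (forall i, (i < p)%N -> lam i = x) ->
  \prod_(0 <= j < p) \prod_(0 <= i < j) weyl_factor lam i j = 1.
Proof.
move=> lam_x; rewrite big_seq big1 // => j.
rewrite mem_index_iota big_seq => /andP[_ jp]; apply: big1 => i.
rewrite mem_index_iota => /andP[_ ij]; rewrite /weyl_factor !lam_x ?subnn //.
  by rewrite divff ?qone_neq0.
exact: ltn_trans ij jp.
Qed.

Lemma prod_weyl_factor_rect lam p s t x y :
    (forall i, (i < p)%N -> lam i = x) ->
    (forall j, (j < s)%N -> lam (p + (t + j))%N = y) ->
  \prod_(0 <= i < p) \prod_(0 <= j < s) weyl_factor lam i (p + (t + j)) =
  qrect (x - y + t) p s / qrect t p s.
Proof.
move=> lam_x lam_y; rewrite -prodf_div big_nat_rev; apply: eq_big_nat => i ip.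
rewrite -prodf_div; apply: eq_big_nat => j js; rewrite /weyl_factor.
by rewrite lam_x ?lam_y //; [congr (qone _ / qone _)|]; lia.
Qed.

Lemma skew_degree_straight n b c d m :
  (\sum_(0 <= j < n + d + m) j * nth 0 (fat_hook n 0 b c d) j)%N =
  skew_degree n 0 b c d.
Proof.
have cut_sum k x : (k <= n + d + m)%N ->
    (x * 'C(k, 2) = \sum_(0 <= j < n + d + m) if j < k then j * x else 0)%N.
  move=> k_le; rewrite mulnC -bin2_sum big_distrl /=.
  by rewrite (big_nat_widen _ _ (n + d + m)) // big_mkcond.
rewrite (_ : skew_degree _ _ _ _ _ =
  b * 'C(n, 2) + (n + c) * 'C(n + d, 2))%N; last first.
  by rewrite /skew_degree !addn0; lia.
rewrite !cut_sum; try lia.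
rewrite -big_split /=; apply: eq_bigr => j _; rewrite nth_fat_hook !addn0.
by do ?[case: ltnP => ?]; lia.
Qed.

Lemma prod_weyl_factor_fat_hook m n b c d :
  \prod_(0 <= j < n + d + m) \prod_(0 <= i < j)
    weyl_factor (nth 0%N (fat_hook n 0 b c d)) i j =
  (qrect b n d / qrect 0 n d) * (qrect (n + c) d m / qrect 0 d m)
  * (qrect (n + b + c + d) n m / qrect d n m).
Proof.
set lam := nth _ _; pose lamS i := lam (n + i)%N.
have lam_n i : (i < n)%N -> lam i = (n + b + c)%N.
  by move=> i_n; rewrite /lam nth_fat_hook addn0 i_n.
have lamS_d i : (i < d)%N -> lamS i = (n + c)%N.
  move=> i_d; rewrite /lamS /lam nth_fat_hook addn0.
  by do ?[case: ltnP => ?]; lia.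
have lamS_m i : lamS (d + i)%N = 0%N.
  by rewrite /lamS /lam nth_fat_hook addn0; do ?[case: ltnP => ?]; lia.
rewrite -addnA prod_weyl_factor_cat (prod_weyl_factor_const lam_n) mul1r.
rewrite prod_weyl_factor_cat (prod_weyl_factor_const lamS_d) mul1r.
rewrite (@prod_weyl_factor_const (fun i => lamS (d + i)%N) m 0%N) // mul1r.
under [X in _ * X]eq_bigr => i _ do
  rewrite (big_cat_nat (leq0n d) (leq_addr m d)) /= big_nat_shift.
rewrite big_split /=.
rewrite (@prod_weyl_factor_rect lam n d 0 (n + b + c) (n + c)) //.
rewrite (@prod_weyl_factor_rect lam n m d (n + b + c) 0) //; last first.
  by move=> j _; apply: lamS_m.
rewrite (@prod_weyl_factor_rect lamS d m 0 (n + c) 0) //.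
rewrite !subn0 !addn0 (_ : n + b + c - (n + c) = b)%N; last by lia.
by rewrite mulrCA mulrA.
Qed.

Lemma skew_form_straight m n b c d :
  (qrect b n d / qrect 0 n d) * (qrect (n + c) d m / qrect 0 d m)
  * (qrect (n + b + c + d) n m / qrect d n m) =
  skew_form m n 0 b c d.
Proof.
rewrite skew_form_qsuper.
rewrite (@qrectE b n d (n + b + d) (n + b) (b + d)); try lia.
rewrite (@qrectE 0 n d (n + d) n d); try lia.
rewrite (@qrectE (n + c) d m (n + c + d + m) (n + c + d) (n + c + m)); try lia.
rewrite (@qrectE 0 d m (d + m) d m); try lia.
rewrite (@qrectE (n + b + c + d) n m (n + n + b + c + d + m)
                 (n + n + b + c + d) (n + b + c + d + m)); try lia.
rewrite (@qrectE d n m (n + d + m) (n + d) (d + m)); try lia.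
by rewrite !(addn0, add0n) qsuper0; field; rewrite !qsuper_neq0.
Qed.

Lemma skew_det_straight m n b c d : q != 0 ->
  skew_det (n + d + m) n 0 b c d = skew_closed m n 0 b c d.
Proof.
move=> q_neq0; pose lam := nth 0%N (fat_hook n 0 b c d).
transitivity (jtdet (GRing.exp q) (n + d + m) (n + d + m) lam (fun=> 0%N)).
  rewrite /skew_det addn0 [RHS]jtdet_pad => [|i ir|//]; last first.
    by rewrite /lam nth_fat_hook !addn0; do ?[case: ltnP => ?]; lia.
  by apply: jtdet_eq => i j _ _; rewrite nth_nil.
rewrite jtdet_qexp_straight // => [|i]; last first.
  by rewrite /lam !nth_fat_hook; do ?[case: ltnP => ?]; lia.
by rewrite skew_degree_straight prod_weyl_factor_fat_hook skew_form_straight.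
Qed.

Lemma skew_closed_disjoint m a b c d :
  skew_closed m 0 a b c d =
  skew_closed (d + m) 0 0 0 b a * skew_closed (a + m) 0 0 0 c d.
Proof.
rewrite /skew_closed skew_form_disjoint [RHS]mulrACA -exprD; congr (q ^+ _ * _).
by rewrite /skew_degree; lia.
Qed.

Lemma skew_closed_rotate m n a b c :
  skew_closed m n a b c 0 = skew_closed m n 0 c b a.
Proof.
rewrite /skew_closed skew_form_rotate; congr (q ^+ _ * _).
by rewrite /skew_degree !addn0; lia.
Qed.

Theorem skew_detE m n a b c d : q != 0 ->
  skew_det (n + a + d + m) n a b c d = skew_closed m n a b c d.
Proof.
move=> q_neq0; have [r] := ubnP (n + a + d).
elim: r => // r IHr in m n a d *; rewrite ltnS => nad.
case: a nad => [|a] nad; first by rewrite !addn0 skew_det_straight.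
case: d nad => [|d] nad.
  by rewrite skew_det_rotate skew_closed_rotate !addn0 skew_det_straight.
case: n nad => [|n] nad.
  rewrite skew_det_disjoint skew_closed_disjoint -!skew_det_straight //.
  by congr (skew_det _ _ _ _ _ _ * skew_det _ _ _ _ _ _); lia.
have IH m' n' a' d' : (n' + a' + d' < n.+1 + a.+1 + d.+1)%N ->
    (n' + a' + d' + m' = n.+1 + a.+1 + d.+1 + m)%N ->
    skew_det (n.+1 + a.+1 + d.+1 + m) n' a' b c d' =
    skew_closed m' n' a' b c d'.
  by move=> smaller <-; apply: IHr; lia.
have smaller_neq0 : skew_closed m.+2 n.+1 a b c d != 0.
  by rewrite mulf_neq0 ?expf_neq0 ?skew_form_neq0.
apply: (mulIf smaller_neq0); rewrite skew_closed_condensation.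
rewrite -(IH m.+2) ?skew_det_condensation; try lia.
by rewrite (IH m.+1) ?(IH m.+1) ?(IH m.+1) ?(IH m.+1) //; lia.
Qed.

Lemma schur_skew_det n a b c d N :
  schur_principal (skew (fat_hook n a b c d) (nseq a c)) N q =
  skew_det N.+1 n a b c d.
Proof.
rewrite schur_principal_jtdet ?size_fat_hook // => i.
- by rewrite !nth_fat_hook; do ?[case: ltnP => ?]; lia.
- by rewrite !nth_nseq; do ?[case: ltnP => ?]; lia.
- by rewrite nth_fat_hook nth_nseq; do ?[case: ltnP => ?]; lia.
Qed.

(** * Product formulas *)

Lemma qpoch_qone (z : int) e k : z = e.+1%:Z ->
  qpoch (q ^ z) q k = \prod_(0 <= j < k) qone (e + j).
Proof. by move=> ->; apply: eq_bigr => j _; rewrite -exprnP -exprD addSn. Qed.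

Lemma prod_qpoch_up (z : int) e p k : z = e%:Z ->
  \prod_(1 <= i < p.+1) qpoch (q ^ (z + i%:Z)) q k = qrect e p k.
Proof.
by move=> ->; rewrite big_add1; apply: eq_bigr => i _; apply: qpoch_qone; lia.
Qed.

Lemma prod_qpoch_down (z : int) e p k : z = (e + p).+1%:Z ->
  \prod_(1 <= i < p.+1) qpoch (q ^ (z - i%:Z)) q k = qrect e p k.
Proof.
move=> ->; rewrite big_add1 big_nat_rev; apply: eq_big_nat => i ip.
by apply: qpoch_qone; lia.
Qed.

(* The product over [k] telescopes. *)
Lemma prod_macmahon n a c :
  \prod_(1 <= i < n.+1) \prod_(1 <= j < a.+1) \prod_(1 <= k < c.+1)
    ((1 - q ^ (i%:Z + j%:Z + k%:Z - 1)) / (1 - q ^ (i%:Z + j%:Z + k%:Z - 2))) =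
  qrect c n a / qrect 0 n a.
Proof.
rewrite big_add1 -prodf_div; apply: eq_bigr => i _.
rewrite big_add1 -prodf_div; apply: eq_bigr => j _; rewrite big_add1 /=.
transitivity (\prod_(0 <= k < c) (qone (k.+1 + i + j) / qone (k + i + j))).
  apply: eq_bigr => k _.
  have -> : i.+1%:Z + j.+1%:Z + k.+1%:Z - 1 = (k.+1 + i + j).+1%:Z by lia.
  have -> // : i.+1%:Z + j.+1%:Z + k.+1%:Z - 2 = (k + i + j).+1%:Z by lia.
elim: c => [|c IHc]; first by rewrite big_nil divff ?qone_neq0.
by rewrite big_nat_recr //= IHc; field; rewrite !qone_neq0.
Qed.

Lemma prod_hook_cell_rect lam x p y s u v :
    (forall i, (i < p)%N -> part lam (x + i).+1 = (y + s + u)%N) ->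
    (forall j, (j < s)%N -> conj_part lam (y + j).+1 = (x + p + v)%N) ->
  \prod_(z <- cell_rect x p y s) (1 - q ^ hook lam z)^-1 =
  (qrect (u + v) p s)^-1.
Proof.
move=> row col; rewrite big_cell_rect -prodfV [RHS]big_nat_rev /=.
apply: eq_big_nat => i /andP[_ ip]; rewrite -prodfV [RHS]big_nat_rev /=.
apply: eq_big_nat => j /andP[_ js]; congr (_^-1).
rewrite /qone exprnP; congr (1 - q ^ _).
by rewrite /hook /= row // col //; lia.
Qed.

Lemma prod_hook_fat_hook n a b c d :
  \prod_(z <- cells_diff (diagram (fat_hook n a b c d))
                         (skew (nseq (n + a) c) (nseq n c)))
     (1 - q ^ hook (fat_hook n a b c d) z)^-1 =
  (qrect 0 (n + a) b * qrect (a + b + d) n (n + c) * qrect (b + d) a n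
   * qrect 0 d (n + c))^-1.
Proof.
rewrite (perm_big _ (perm_fat_hook_diff n a b c d)) !big_cat /=.
rewrite (@prod_hook_cell_rect _ 0 (n + a) (n + c) b 0 0).
rewrite (@prod_hook_cell_rect _ 0 n 0 (n + c) b (a + d)).
rewrite (@prod_hook_cell_rect _ n a c n b d).
rewrite (@prod_hook_cell_rect _ (n + a) d 0 (n + c) 0 0).
  by rewrite (_ : b + (a + d) = a + b + d)%N ?invfM ?mulrA //; lia.
all: move=> i i_lt; rewrite ?conj_fat_hook /part ?nth_fat_hook.
all: by do ?[case: ltnP => ?]; lia.
Qed.

(** * Polynomials in [q^N] *)

Definition qpoly (f : nat -> K) : Prop :=
  exists p : {poly K}, forall N, f N = p.[q ^+ N].

Lemma qpoly_ext f g : f =1 g -> qpoly f -> qpoly g.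
Proof. by move=> fg [p fp]; exists p => N; rewrite -fg. Qed.

Lemma qpoly_const x : qpoly (fun=> x).
Proof. by exists x%:P => N; rewrite hornerC. Qed.

Lemma qpolyD f g : qpoly f -> qpoly g -> qpoly (fun N => f N + g N).
Proof.
by move=> [p fp] [r gr]; exists (p + r) => N; rewrite hornerD fp gr.
Qed.

Lemma qpolyM f g : qpoly f -> qpoly g -> qpoly (fun N => f N * g N).
Proof.
by move=> [p fp] [r gr]; exists (p * r) => N; rewrite hornerM fp gr.
Qed.

Lemma qpoly_sum I (s : seq I) (f : I -> nat -> K) :
  (forall i, qpoly (f i)) -> qpoly (fun N => \sum_(i <- s) f i N).
Proof.
move=> fp; elim: s => [|i s IHs].
  by apply: qpoly_ext (qpoly_const 0) => N; rewrite big_nil.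
by apply: qpoly_ext (qpolyD (fp i) IHs) => N; rewrite big_cons.
Qed.

Lemma qpoly_prod I (s : seq I) (f : I -> nat -> K) :
  (forall i, qpoly (f i)) -> qpoly (fun N => \prod_(i <- s) f i N).
Proof.
move=> fp; elim: s => [|i s IHs].
  by apply: qpoly_ext (qpoly_const 1) => N; rewrite big_nil.
by apply: qpoly_ext (qpolyM (fp i) IHs) => N; rewrite big_cons.
Qed.

Lemma qpoly_det r (A : nat -> 'M[K]_r) :
  (forall i j, qpoly (fun N => A N i j)) -> qpoly (fun N => \det (A N)).
Proof.
move=> Ap; apply: qpoly_sum => s; apply: qpolyM (qpoly_const _) _.
by apply: qpoly_prod => i; apply: Ap.
Qed.

Lemma qpoly_1sub x : qpoly (fun N => 1 - q ^+ N * x).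
Proof.
exists (1 - x *: 'X) => N.
by rewrite hornerD hornerN hornerZ hornerX hornerC mulrC.
Qed.

Lemma qpoly_eventually_eq f g N0 : q != 0 -> qpoly f -> qpoly g ->
  (forall N, (N0 <= N)%N -> f N = g N) -> f =1 g.
Proof.
move=> q_neq0 [p fp] [r gr] fg N; rewrite fp gr; congr _.[_].
apply/eqP; rewrite -subr_eq0; apply: contraT => p_neq_r.
have := @max_poly_roots _ _
  [seq q ^+ (N0 + i)%N | i <- iota 0 (size (p - r))] p_neq_r.
rewrite size_map size_iota ltnn; apply.
  apply/allP=> _ /mapP[i _ ->].
  by rewrite rootE hornerD hornerN -fp -gr fg ?leq_addr // subrr.
by rewrite map_inj_uniq ?iota_uniq // => i j /(qexp_inj q_neq0)/addnI.
Qed.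

Lemma qpoly_hsymz (z : int) : qpoly (fun N => hsymz (GRing.exp q) N.+1 z).
Proof.
case: z => k; last exact: qpoly_const.
pose f N := (qfact k)^-1 * \prod_(0 <= i < k) (1 - q ^+ N * q ^+ i.+1).
have fp : qpoly f.
  by apply: qpolyM (qpoly_const _) _; apply: qpoly_prod => i; apply: qpoly_1sub.
apply: qpoly_ext fp => N; rewrite /f /hsymz hsym_qexp qfactD.
under eq_bigr => i _ do rewrite -exprD addnS.
by rewrite -mulf_div divff ?qfact_neq0 // mul1r mulrC.
Qed.

Lemma qpoly_skew_det n a b c d : qpoly (fun N => skew_det N.+1 n a b c d).
Proof.
apply: qpoly_det => i j; apply: qpoly_ext (qpoly_hsymz _) => N.
by rewrite mxE.
Qed.

Lemma qpoly_prod_qpoch (e : nat -> nat -> int) s k :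
    q != 0 -> (forall N i, e N i = N%:Z + e 0%N i) ->
  qpoly (fun N => \prod_(i <- s) qpoch (q ^ e N i) q k).
Proof.
move=> q_neq0 eN; apply: qpoly_prod => i; apply: qpoly_prod => j.
apply: qpoly_ext (qpoly_1sub (q ^ e 0%N i * q ^+ j)) => N.
by rewrite (eN N) expfzDr // mulrA.
Qed.

End PrincipalSpecialization.

Lemma ratq_neq0 : ratq != 0.
Proof. by rewrite tofrac_eq0 polyX_eq0. Qed.

Lemma ratq_expS_neq1 k : ratq ^+ k.+1 != 1.
Proof.
rewrite -rmorphXn -tofrac1 -subr_eq0 -rmorphB tofrac_eq0.
by rewrite -size_poly_eq0 size_XnsubC.
Qed.

Theorem theorem5p1 (n a b c d N : nat) :
  let q := ratq in
  let lam := nseq (n + a) (n + b + c)%N ++ nseq d (n + c)%N in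
  let pi := skew lam (nseq a c) in
  schur_principal pi N q =
    q ^ (\sum_(x <- pi) ((conj_part lam x.2)%:Z - x.1%:Z))
    * \prod_(1 <= i < b.+1) qpoch (q ^ (N%:Z - a%:Z + 1 + i%:Z)) q a
    * \prod_(1 <= i < d.+1) qpoch (q ^ (N%:Z + 2 - i%:Z)) q c
    * \prod_(1 <= i < n.+1)
        qpoch (q ^ (N%:Z - n%:Z - a%:Z - d%:Z + 1 + i%:Z)) q
              (n + a + b + c + d)%N
    * \prod_(1 <= i < n.+1) \prod_(1 <= j < a.+1) \prod_(1 <= k < c.+1)
        ((1 - q ^ (i%:Z + j%:Z + k%:Z - 1))
         / (1 - q ^ (i%:Z + j%:Z + k%:Z - 2)))
    * \prod_(x <- cells_diff (diagram lam)
                             (skew (nseq (n + a) c) (nseq n c)))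
        (1 - q ^ hook lam x)^-1.
Proof.
move=> q lam pi; have [q_neq0 q_exp] := (ratq_neq0, ratq_expS_neq1).
move: N; apply: (qpoly_eventually_eq q_exp q_neq0 (N0 := n + a + d)).
- apply: qpoly_ext (qpoly_skew_det q_exp n a b c d) => N.
  by rewrite -schur_skew_det.
- by do !apply: qpolyM; try exact: qpoly_const;
    apply: qpoly_prod_qpoch => // N i; lia.
move=> N N_large; have [m N_rows] : exists m, N.+1 = (n + a + d + m)%N.
  by exists (N.+1 - (n + a + d))%N; lia.
rewrite schur_skew_det N_rows skew_detE // /skew_closed /skew_form skew_degreeE.
rewrite (@prod_qpoch_up _ _ _ (n + d + m)); last by lia.
rewrite (@prod_qpoch_down _ _ _ (n + a + m)); last by lia.
rewrite (@prod_qpoch_up _ _ _ m); last by lia.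
by rewrite prod_macmahon // prod_hook_fat_hook // !mulrA.
Qed.
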